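(* Let $\mathcal{S}$ be a submanifold of $\mathbb{R}^n$ and let $\overline{\mathcal{S}}\subset\mathbb{D}^n$ be its normal bundle. The Lagrangian submanifold $\overline{\mathcal{S}}$ is minimal with respect to the neutral metric $\langle\cdot,\cdot\rangle$ if and only if $\mathcal{S}$ is austere.
   Context: $\mathbb{D}$ is the algebra of para-complex numbers $z=x+\tau y$, $x,y\in\mathbb{R}$, $\tau^2=1$. On $\mathbb{D}^n\simeq\mathbb{R}^n\oplus\mathbb{R}^n$ (with $x+\tau y\leftrightarrow(x,y)$) the para-complex structure is $J(x,y)=(y,x)$ (multiplication by $\tau$), the neutral metric is $\langle\cdot,\cdot\rangle=\sum_{j=1}^n(dx_j^2-dy_j^2)$, and the symplectic form is $\omega=\langle\cdot,J\cdot\rangle$. The normal bundle of a submanifold $\mathcal{S}\subset\mathbb{R}^n$ (with $\mathbb{R}^n$ carrying its Euclidean metric) is $\overline{\mathcal{S}}=\{(x,\nu)\in\mathbb{D}^n=\mathbb{R}^n\oplus\mathbb{R}^n : x\in\mathcal{S},\ \nu\in N_x\mathcal{S}\}$; it is a Lagrangian submanifold of $\mathbb{D}^n$ (dimension $n$, $\omega$ vanishes on it). $\mathcal{S}$ is austere if for any normal vector field $\nu$, the eigenvalues of the quadratic form $A_\nu:=\langle h(\cdot,\cdot),\nu\rangle$ (with $h$ the second fundamental form of $\mathcal{S}$ in Euclidean $\mathbb{R}^n$ and $\langle\cdot,\cdot\rangle$ here the Euclidean inner product), counted with multiplicity, are symmetrically arranged around zero on the real line. The metric induced on $\overline{\mathcal{S}}$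 by the neutral metric may be degenerate at some points. $\overline{\mathcal{S}}$ is minimal means that its mean curvature vector $\vec H$ vanishes at all points where the induced metric is non-degenerate, where $n\vec H=\sum_{i=1}^n\epsilon_i h(e_i,e_i)$ for a local orthonormal tangent frame $(e_i)$ of $\overline{\mathcal{S}}$ with $\epsilon_i=\langle e_i,e_i\rangle=\pm1$, $h(X,Y)=(D_XY)^\perp$ now denoting the second fundamental form of $\overline{\mathcal{S}}$, and $D$ the flat connection of $\mathbb{D}^n$. *)

(* Defs.v *)
From HB Require Import structures.
From mathcomp Require Export all_boot all_order all_algebra.
From mathcomp Require Export all_classical all_reals all_analysis.
Export Order.TTheory GRing.Theory Num.Theory.
Export numFieldNormedType.Exports.

Set Implicit Arguments.
Unset Strict Implicit.
Unset Printing Implicit Defensive.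

Local Open Scope classical_set_scope.
Local Open Scope ring_scope.

(** Submanifolds are embedded, smooth ([C^oo]) and without boundary; they are
    subsets of the ambient space covered by smooth local parametrizations. *)

Section Smooth.
Variables (R : realType) (k : nat) (E : normedModType R).

Fixpoint Ck (m : nat) (V : set 'rV[R]_k) (f : 'rV[R]_k -> E) : Prop :=
  match m with
  | 0 => forall u, V u -> {for u, continuous f}
  | m'.+1 => (forall u, V u -> differentiable f u) /\
             (forall v : 'rV[R]_k, Ck m' V (fun u => 'D_v f u))
  end.

Definition smooth (V : set 'rV[R]_k) (f : 'rV[R]_k -> E) : Prop :=
  forall m, Ck m V f.

End Smooth.

(** [E] is the flat ambient space and [g] a constant metric on it, of any
    signature; [k] is the dimension of the submanifold [M]. *)

Section Submanifolds.
Variables (R : realType) (E : normedModType R) (g : E -> E -> R).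
Variables (k : nat) (M : set E).

(** The last clause says that [phi] is open onto [M] for the subspace topology,
    so that [phi] is a homeomorphism of [V] onto a relatively open part of
    [M]. *)
Definition chart (V : set 'rV[R]_k) (phi : 'rV[R]_k -> E) : Prop :=
  [/\ open V,
      smooth V phi,
      forall u, V u -> injective ('d phi u),
      set_inj V phi &
      phi @` V `<=` M /\
      forall W : set 'rV[R]_k, open W -> W `<=` V ->
        exists2 O : set E, open O & phi @` W = O `&` M].

Definition submanifold : Prop :=
  forall q, M q -> exists V phi, chart V phi /\ (phi @` V) q.

Definition tangent_space (q : E) : set E :=
  [set X | exists V phi u xi,
     [/\ chart V phi, V u, phi u = q & X = 'd phi u xi]].

Definition normal_space (q : E) : set E :=
  [set nu | forall X, tangent_space q X -> g nu X = 0].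

(** Local vector fields on [M], read in the parametrization [phi]: the vector
    attached to the point [phi u] is [Y u]. *)
Definition tangent_field (V : set 'rV[R]_k) (phi Y : 'rV[R]_k -> E) : Prop :=
  smooth V Y /\ forall u, V u -> tangent_space (phi u) (Y u).

Definition normal_field (V : set 'rV[R]_k) (phi nu : 'rV[R]_k -> E) : Prop :=
  smooth V nu /\ forall u, V u -> normal_space (phi u) (nu u).

(** [h(X, Y0) = (D_X Y)^\perp] at [q], where [Y] is any tangent field with value
    [Y0] at [q]: as [X = 'd phi u xi], the flat derivative [D_X Y] is
    ['D_xi Y u], and its normal part is the normal vector [z] such that
    [D_X Y - z] is tangent. The value is unique wherever the metric induced on
    the tangent space at [q] is non-degenerate; it has no meaning elsewhere. *)
Definition second_ff (q X Y0 : E) : E :=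
  get [set z | exists V phi u xi Y,
    [/\ chart V phi, V u /\ phi u = q, X = 'd phi u xi,
        tangent_field V phi Y /\ Y u = Y0 &
        normal_space q z /\ tangent_space q ('D_xi Y u - z)]].

Definition nondegenerate (q : E) : Prop :=
  forall X, tangent_space q X ->
    (forall Y, tangent_space q Y -> g X Y = 0) -> X = 0.

(** Being [k] in number, such vectors form a basis of the tangent space. *)
Definition orthonormal_frame (q : E) (e : 'I_k -> E) : Prop :=
  [/\ forall i, tangent_space q (e i),
      forall i, g (e i) (e i) = 1 \/ g (e i) (e i) = -1 &
      forall i j, i != j -> g (e i) (e j) = 0].

Definition mean_curvature (q : E) (e : 'I_k -> E) : E :=
  k%:R^-1 *: \sum_(i < k) g (e i) (e i) *: second_ff q (e i) (e i).

Definition minimal : Prop :=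
  forall q, M q -> nondegenerate q ->
    forall e, orthonormal_frame q e -> mean_curvature q e = 0.

Definition shape_form (q nu : E) (X Y : E) : R := g (second_ff q X Y) nu.

(** The eigenvalues of the form [A_nu], relative to the induced metric, are
    those of its matrix in an orthonormal basis. The criterion below is meant
    for a positive definite [g]: that matrix is then real symmetric, so the
    roots of its characteristic polynomial are all real and their multiplicities
    are those of the eigenvalues. *)
Definition austere : Prop :=
  forall V phi nu, chart V phi -> normal_field V phi nu ->
    forall u, V u -> forall e, orthonormal_frame (phi u) e ->
      let A := \matrix_(i < k, j < k)
                 shape_form (phi u) (nu u) (e i) (e j) in
      forall lambda : R,
        mup lambda (char_poly A) = mup (- lambda) (char_poly A).

End Submanifolds.

Section ParaComplex.
Variables (R : realType) (n : nat).

Definition euclidean (x y : 'rV[R]_n) : R := \sum_(j < n) x 0 j * y 0 j.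

(** [D^n] as [R^n + R^n], the pair [(x, y)] standing for [x + tau y]. *)
Definition paraD : normedModType R := ('rV[R]_n * 'rV[R]_n)%type.

Definition neutral (z w : paraD) : R :=
  \sum_(j < n) (z.1 0 j * w.1 0 j - z.2 0 j * w.2 0 j).

Definition normal_bundle (p : nat) (S : set 'rV[R]_n) : set paraD :=
  [set z | S z.1 /\ normal_space euclidean p S z.1 z.2].

End ParaComplex.

(* Main.v *)
From HB Require Import structures.
Require Import Defs.
From mathcomp Require Import perm complex ring lra.

Local Open Scope classical_set_scope.
Local Open Scope ring_scope.

Set Implicit Arguments.
Unset Strict Implicit.
Unset Printing Implicit Defensive.

(** Let [phi] parametrize [S] and let [nu] be a normal field along it, linear in the
    fibre coordinates [s]; then [(u, s) |-> (phi u, nu)] parametrizes the normal bundle.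
    On the para-complex space use the null coordinates [x + y] and [x - y]: the
    structure [J] acts on them by [1] and [-1], and the neutral metric pairs the first
    with the second. For a parametrization [Phi] of a Lagrangian submanifold let [P] and
    [Q] be the square matrices whose rows are the null coordinates of the partial
    derivatives of [Phi]. The Lagrangian condition makes [P Q^T] symmetric, and then
    [P Q^T] is the Gram matrix of the induced metric. Pairing [n H] with the normal
    vector [J (d Phi eta)], using the symmetry of second derivatives and Jacobi's formula,
    gives half of the derivative of [ln (det Q / det P)] along [eta]
    ([mean_curvature_lagrangian]). So the submanifold is minimal exactly when
    [det Q / det P] is locally constant at the points where neither determinant
    vanishes.

    For the normal bundle, multiplying [P] and [Q] by the matrix of a tangent and of a
    normal frame makes them block triangular, and with [A] the matrix of the shape form of
    [nu] in an orthonormal frame one finds, up to the same non-zero factor depending on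
    [u] alone, [det P = det (1 - A)] and [det Q = (-1)^m det (1 + A)], where [m] is the
    codimension ([det_tangent_mx], [shape_mx_det]).

    If [S] is austere, the eigenvalues of the symmetric matrix [A], all real, are
    permuted by the change of sign, so [det (1 + A) = det (1 - A)] at every normal vector,
    and [det Q / det P] is constant ([austere_det]).

    Conversely, follow the ray [t nu] in a fibre. Minimality says that the polynomials
    [det (1 + t A)] and [det (1 - t A)] have the same logarithmic derivative wherever
    neither vanishes; both equal [1] at [0], so they coincide ([minimal_pencil]), which is
    the parity of the characteristic polynomial of [A] ([det_sym_mup]).

    Tangent spaces and second fundamental forms are defined through all charts at once.
    A line read in another chart is a differentiable curve ([chart_transition]), and
    differentiating [g (Y, nu) = 0] along it expresses the second fundamental form by the
    derivative of one normal field in one chart ([second_ff_normal_field]). *)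

(** * Real matrices and their characteristic polynomials *)

Section RealMatrices.
Variable R : rcfType.

Lemma row_self_dot_eq0 n (v : 'rV[R]_n) : v *m v^T = 0 -> v = 0.
Proof.
move=> /matrixP /(_ 0 0); rewrite !mxE => h.
have : \sum_(j < n) v 0 j ^+ 2 == 0.
  by rewrite -[X in _ == X]h; apply/eqP/eq_bigr => j _; rewrite mxE expr2.
rewrite psumr_eq0; last by move=> *; apply: sqr_ge0.
move=> /allP h0; apply/rowP => j; rewrite mxE.
have := h0 j; rewrite mem_index_enum => /(_ isT) /=.
by rewrite sqrf_eq0 => /eqP.
Qed.

(** A combination of the rows in the kernel of the Gram matrix has length zero. *)
Lemma gram_unitmx p n (T : 'M[R]_(p, n)) : row_free T -> T *m T^T \in unitmx.
Proof.
move=> fT; rewrite -row_free_unit -kermx_eq0; apply/eqP/row_matrixP => i.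
rewrite row0; set v := row i _.
have v0 : v *m (T *m T^T) = 0.
  by apply: sub_kermxP; rewrite row_sub.
have : v *m T = 0.
  apply: row_self_dot_eq0; rewrite trmx_mul mulmxA -(mulmxA v) v0 mul0mx //.
by move=> h; apply: (row_free_inj fT); rewrite mul0mx.
Qed.

Lemma complete_unitmx p m (T : 'M[R]_(p, p + m)) : row_free T ->
  exists W : 'M[R]_(m, p + m), col_mx T W \in unitmx.
Proof.
move=> /eqP fT; exists (dsubmx (row_ebase T)).
have -> : col_mx T (dsubmx (row_ebase T)) =
   block_mx (col_ebase T) 0 0 1%:M *m row_ebase T.
  rewrite -[in RHS](vsubmxK (row_ebase T)) mul_block_col !mul0mx mul1mx addr0 add0r.
  congr col_mx; rewrite -[LHS]mulmx_ebase fT -mulmxA.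
  congr (_ *m _); rewrite -[in LHS](vsubmxK (row_ebase T)).
  by rewrite pid_mx_row mul_row_col mul0mx addr0 mul1mx.
rewrite unitmx_mul row_ebase_unit andbT unitmxE det_ublock det1 mulr1.
by rewrite -unitmxE col_ebase_unit.
Qed.

Lemma mulmx_deltas n (B : 'M[R]_n) i j :
  ((delta_mx 0 i : 'rV_n) *m B *m (delta_mx 0 j : 'rV_n)^T) 0 0 = B i j.
Proof. by rewrite -rowE trmx_delta -colE !mxE. Qed.

(** Polarization: a symmetric form is determined by its values on the diagonal. *)
Lemma sym_neq0_vec n (G : 'M[R]_n) : G^T = G -> G != 0 ->
  exists v : 'rV[R]_n, (v *m G *m v^T) 0 0 != 0.
Proof.
move=> sG; apply: contraNP => nex; apply/eqP/matrixP => i j.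
have q0 (v : 'rV_n) : (v *m G *m v^T) 0 0 = 0.
  by apply/eqP/negbNE/negP => h; apply: nex; exists v.
have addE (a b : 'M[R]_1) : (a + b) 0 0 = a 0 0 + b 0 0 by rewrite mxE.
have := q0 (delta_mx 0 i + delta_mx 0 j).
rewrite [(_ + _)^T]linearD /= !mulmxDl !mulmxDr !addE !mulmx_deltas.
have := q0 (delta_mx 0 i); have := q0 (delta_mx 0 j).
rewrite !mulmx_deltas => Gjj Gii.
rewrite Gii Gjj add0r addr0 -[in G j i]sG mxE -mulr2n => /eqP.
by rewrite mulrn_eq0 /= => /eqP ->; rewrite mxE.
Qed.

(** Sylvester's diagonalization, by induction: a non-isotropic vector, rescaled to
    square length 1 or -1, is split off, and the form stays non-degenerate on its
    orthogonal complement. It supplies orthonormal frames for the Euclidean and for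
    the neutral metric. *)
Lemma sym_congruence n (G : 'M[R]_n) : G^T = G -> G \in unitmx ->
  exists (E : 'M[R]_n) (eps : 'I_n -> R), (forall i, eps i = 1 \/ eps i = -1) /\
    E *m G *m E^T = diag_mx (\row_i eps i).
Proof.
elim: n G => [|n IHn] G sG uG.
  by exists 1%:M, (fun=> 1); split; [left | apply/matrixP => -[]].
have G0 : G != 0.
  by apply: contraL uG => /eqP ->; rewrite unitmxE det0 unitr0.
have [v0 nz0] := sym_neq0_vec sG G0.
pose a := (Num.sqrt `|(v0 *m G *m v0^T) 0 0|)^-1.
set q := (v0 *m G *m v0^T) 0 0 in nz0 a.
pose v := a *: v0.
pose c : R := (v *m G *m v^T) 0 0.
have cE : c = q / `|q|.
  rewrite /c /v linearZ /= -scalemxAl -scalemxAr -scalemxAl scalerA mxE -/q mulrC.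
  by rewrite /a -expr2 exprVn sqr_sqrtr.
have c1 : c = 1 \/ c = -1.
  rewrite cE; case: (ltrgt0P q) nz0 => [q0|q0|->] // _.
    by left; rewrite divff ?gt_eqF.
  by right; rewrite invrN mulrN divff ?lt_eqF.
have cc : c * c = 1 by case: c1 => ->; rewrite ?mulrNN mulr1.
have cn0 : c != 0 by case: c1 => ->; rewrite ?oppr_eq0 oner_neq0.
have vn0 : v != 0.
  apply: contraNN cn0 => /eqP; rewrite /c => ->; rewrite !mul0mx mxE //.
have vf : row_free (v : 'M[R]_(1, 1 + n)) by rewrite /row_free rank_rV vn0.
have [W uW] := complete_unitmx vf.
pose E1 : 'M[R]_(1 + n) := col_mx v W.
pose G1 : 'M[R]_(1 + n) := E1 *m G *m E1^T.
have sG1 : G1^T = G1 by rewrite /G1 !trmx_mul trmxK sG mulmxA.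
have G1E : G1 = block_mx c%:M (ursubmx G1) (ursubmx G1)^T (drsubmx G1).
  rewrite -[LHS]submxK; congr block_mx.
    rewrite /G1 /E1 tr_col_mx mul_col_mx mul_col_row block_mxKul.
    by rewrite [LHS]mx11_scalar.
  by rewrite trmx_ursub sG1.
set b := ursubmx G1 in G1E; set D := drsubmx G1 in G1E.
have sD : D^T = D by rewrite /D trmx_drsub sG1.
(* Subtract from the other vectors their components along v; c is its own inverse. *)
pose E2 : 'M[R]_(1 + n) := block_mx 1%:M 0 (- c *: b^T) 1%:M.
pose D' := D - c *: (b^T *m b).
have E2G : E2 *m G1 *m E2^T = block_mx c%:M 0 0 D'.
  rewrite G1E /E2 tr_block_mx !trmx1 trmx0 mulmx_block.
  rewrite !mul1mx !mul0mx !addr0.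
  rewrite mulmx_block !mulmx0 !mulmx1 !addr0 !mul_mx_scalar.
  have e1 : c *: (- c *: b^T) + b^T = 0.
    by rewrite scalerA mulrN cc scaleN1r addNr.
  rewrite e1 !mul0mx !add0r; congr block_mx.
    by rewrite linearZ /= trmxK mul_scalar_mx scalerA mulrN cc scaleN1r addNr.
  by rewrite -scalemxAl addrC scaleNr.
have uD' : D' \in unitmx.
  have : block_mx (c%:M : 'M[R]_1) 0 0 D' \in unitmx.
    rewrite -E2G !unitmx_mul !unitmx_tr uG uW.
    by rewrite unitmxE det_lblock !det1 mulr1 unitr1.
  by rewrite unitmxE det_lblock unitrM => /andP[_]; rewrite -unitmxE.
have sD' : D'^T = D'.
  by rewrite /D' linearB /= linearZ /= trmx_mul trmxK sD.
have [E3 [eps [heps E3G]]] := IHn D' sD' uD'.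
pose E4 : 'M[R]_(1 + n) := block_mx 1%:M 0 0 E3.
exists (E4 *m E2 *m E1), (fun i : 'I_(1 + n) =>
  match fintype.split i with inl _ => c | inr j => eps j end).
split.
  by move=> i /=; case: fintype.split.
have -> : E4 *m E2 *m E1 *m G *m (E4 *m E2 *m E1)^T = E4 *m (E2 *m G1 *m E2^T) *m E4^T.
  by rewrite /G1 !trmx_mul !mulmxA.
rewrite E2G /E4 tr_block_mx !trmx1 !trmx0 !mulmx_block.
rewrite !(mul0mx, mulmx0, mul1mx, mulmx1, addr0, add0r) E3G.
have -> : (\row_i match fintype.split i with inl _ => c | inr j => eps j end) =
   row_mx (const_mx c : 'rV_1) (\row_j eps j).
  by apply/rowP => i; rewrite !mxE; case: fintype.split => j; rewrite !mxE.
have := diag_mx_row (const_mx c : 'rV[R]_1) (\row_j eps j).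
by rewrite diag_const_mx => ->.
Qed.

(** Eigenvalues of a real symmetric matrix are real: if v A = z v, then the product
    of v A with the conjugate of v is both z |v|^2 and its conjugate. *)
Lemma charpoly_map_real n (A : 'M[R]_n) (z : R[i]) : A^T = A ->
  root (char_poly (map_mx (real_complex R) A)) z -> exists r, z = r%:C%C.
Proof.
move=> sA; rewrite -eigenvalue_root_char => /eigenvalueP[v vA v0].
pose A' := map_mx (real_complex R) A.
pose q : R[i] := (v *m (map_mx Num.conj v)^T) 0 0.
have q0 : q != 0.
  rewrite /q mxE.
  have e : \sum_j v 0 j * (map_mx Num.conj v)^T j 0 = \sum_j `|v 0 j| ^+ 2.
    by apply: eq_bigr => j _; rewrite !mxE normCK.
  rewrite e psumr_eq0; last by move=> *; rewrite exprn_ge0.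
  apply: contraNN v0 => /allP h; apply/eqP/rowP => j; rewrite mxE.
  have := h j; rewrite mem_index_enum => /(_ isT) /=.
  by rewrite sqrf_eq0 normr_eq0 => /eqP.
have conjA : map_mx Num.conj A' = A'.
  by apply/matrixP => i j; rewrite !mxE; apply: conj_Creal; rewrite complex_real.
have sA' : A'^T = A'.
  by apply/matrixP => i j; rewrite !mxE -[in RHS]sA mxE.
have e1 : (v *m A' *m (map_mx Num.conj v)^T) 0 0 = z * q.
  by rewrite vA -scalemxAl mxE.
have e2 : (v *m A' *m (map_mx Num.conj v)^T) 0 0 = Num.conj z * q.
  have <- : (v *m (map_mx Num.conj (v *m A'))^T) 0 0 = Num.conj z * q.
    rewrite vA map_mxZ linearZ /= -scalemxAr mxE //.
  by rewrite map_mxM conjA trmx_mul mulmxA sA'.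
have : z \is Num.real.
  apply/CrealP; apply: (mulIf q0); rewrite -e1 -e2 //.
move=> /complex_realP [r ->]; by exists r.
Qed.

(** Over the reals, multiplicities of roots determine only the split part of a
    polynomial; for a symmetric matrix that is everything. *)
Lemma sym_char_poly_splits n (A : 'M[R]_n) : A^T = A ->
  exists rs, char_poly A = \prod_(r <- rs) ('X - r%:P).
Proof.
move=> sA; pose A' := map_mx (real_complex R) A.
have [zs hzs] := closed_field_poly_normal (char_poly A').
have real_zs : forall z, z \in zs -> exists r, z = r%:C%C.
  move=> z zin; apply: (charpoly_map_real sA); rewrite hzs.
  rewrite rootZ ?root_prod_XsubC // lead_coef_eq0.
  by rewrite monic_neq0 // char_poly_monic.
have [rs zsE] : exists rs, zs = map (real_complex R) rs :> seq R[i].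
  elim: (zs) real_zs => [|z l IH] h; first by exists [::].
  have [r zE] := h z (mem_head _ _).
  have [rs lE] := IH (fun w hw => h w (@mem_behead _ (z :: l) w hw)).
  by exists (r :: rs); rewrite zE lE.
exists rs; apply: (map_poly_inj (real_complex R)).
rewrite map_char_poly -/A' hzs zsE (monicP (char_poly_monic A')) scale1r.
rewrite rmorph_prod big_map; apply: eq_bigr => r _.
by rewrite rmorphB /= map_polyX map_polyC.
Qed.

Lemma mup_prod_XsubC (x : R) rs : mup x (\prod_(r <- rs) ('X - r%:P)) = count_mem x rs.
Proof.
elim: rs => [|r rs IH]; first by rewrite big_nil /= mupNroot // root1.
rewrite big_cons mupM ?polyXsubC_eq0 //; last first.
  by rewrite monic_neq0 // monic_prod_XsubC.
by rewrite IH -[X in mup _ X]expr1 mup_XsubCX /=; case: eqVneq.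
Qed.

Lemma horner_char_poly n (A : 'M[R]_n) x : (char_poly A).[x] = \det (x%:M - A).
Proof.
rewrite -horner_evalE -det_map_mx; congr (\det _); apply/matrixP => i j.
by rewrite !mxE /= /horner_eval hornerD hornerN hornerC hornerMn hornerX.
Qed.

Lemma detN n (A : 'M[R]_n) : \det (- A) = (-1) ^+ n * \det A.
Proof. by rewrite -scaleN1r detZ. Qed.

(** The multiset of roots is stable under change of sign, and the two determinants
    are the products of 1 + r and of 1 - r over it. *)
Lemma mup_sym_det n (A : 'M[R]_n) : A^T = A ->
  (forall x, mup x (char_poly A) = mup (- x) (char_poly A)) ->
  \det (1%:M + A) = \det (1%:M - A).
Proof.
move=> sA hmup; have [rs hrs] := sym_char_poly_splits sA.
have prs : perm_eq rs (map -%R rs).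
  apply/allP => x _; apply/eqP; have := hmup x; rewrite hrs !mup_prod_XsubC => ->.
  by rewrite count_map; apply: eq_count => y /=; rewrite eqr_oppLR.
have szrs : size rs = n.
  by have := size_char_poly A; rewrite hrs size_prod_XsubC => -[].
rewrite -horner_char_poly hrs horner_prod.
have -> : \det (1%:M + A) = (-1) ^+ n * (char_poly A).[-1].
  rewrite horner_char_poly -detN; congr (\det _).
  by rewrite opprB raddfN opprK addrC.
rewrite hrs -szrs (perm_big _ prs) /= big_map horner_prod.
elim: rs {hrs prs szrs} => [|r rs IH]; first by rewrite !big_nil mulr1.
rewrite !big_cons /= exprS -IH !(hornerD, hornerN, hornerC, hornerX).
set q := \prod_(_ <- _) _; ring.
Qed.

Lemma poly_eq0_horner (p : {poly R}) : (forall x, p.[x] = 0) -> p = 0.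
Proof.
move=> h; apply: (@roots_geq_poly_eq0 _ p [seq k%:R | k <- iota 0 (size p)]).
- by apply/allP => x _; apply/rootP.
- by rewrite map_inj_uniq ?iota_uniq // => i j /eqP; rewrite eqr_nat => /eqP.
- by rewrite size_map size_iota.
Qed.

(** With t = 1 / x the hypothesis says that the characteristic polynomial is even or
    odd, according to the size of A. *)
Lemma det_sym_mup n (A : 'M[R]_n) :
  (forall t, \det (1%:M + t *: A) = \det (1%:M - t *: A)) ->
  forall x, mup x (char_poly A) = mup (- x) (char_poly A).
Proof.
move=> hdet.
pose P := char_poly A.
pose Q := (-1) ^+ n *: (P \Po (- 'X)).
have PQ : P = Q.
  have e : forall x, x != 0 -> P.[x] = Q.[x].
    move=> x x0; rewrite /P /Q hornerZ horner_comp !horner_char_poly !hornerE.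
    rewrite -detN opprB raddfN opprK.
    have -> : A + x%:M = x *: (1%:M + x^-1 *: A).
      by rewrite scalerDr scalerA divff // scale1r addrC scalemx1.
    have -> : x%:M - A = x *: (1%:M - x^-1 *: A).
      by rewrite scalerBr scalerA divff // scale1r scalemx1.
    by rewrite !detZ hdet.
  have : 'X * (P - Q) = 0.
    apply: poly_eq0_horner => x; have [->|x0] := eqVneq x 0.
      by rewrite hornerM hornerX mul0r.
    by rewrite hornerM hornerD hornerN (e x x0) subrr mulr0.
  by move=> /eqP; rewrite mulf_eq0 polyX_eq0 /= subr_eq0 => /eqP.
have P0 : P != 0 by rewrite monic_neq0 // char_poly_monic.
have le x : (mup x P <= mup (- x) P)%N.
  rewrite mup_geq //; have : ('X - x%:P) ^+ mup x P %| P by rewrite -mup_geq.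
  move=> /dvdpP[q hq]; set k := mup x P in hq *.
  rewrite PQ /Q hq comp_polyM rmorphXn /= comp_polyB comp_polyX comp_polyC.
  have -> : - 'X - x%:P = - ('X - (- x)%:P) :> {poly R}.
    by rewrite polyCN opprK opprD.
  by rewrite scalerAl (exprNn ('X - _)) mulrA dvdp_mull.
by move=> x; apply/eqP; rewrite eqn_leq le /=; have := le (- x); rewrite opprK.
Qed.

(** Polynomials with equal logarithmic derivatives are proportional, and the values
    at 0 fix the factor. The points where f or g vanishes are excluded because the
    metric induced on the normal bundle degenerates there; a polynomial identity
    that holds off finitely many points holds everywhere. *)
Lemma poly_logderiv_eq (f g : {poly R}) : f.[0] = g.[0] -> f.[0] != 0 ->
  (forall t, f.[t] != 0 -> g.[t] != 0 ->
     f^`().[t] * g.[t] = f.[t] * g^`().[t]) -> f = g.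
Proof.
move=> fg0 f0 h.
have nz p : p.[0] != 0 -> p != 0 :> {poly R}.
  by apply: contraNneq => ->; rewrite horner0.
have E : f^`() * g = f * g^`().
  apply/eqP; rewrite -subr_eq0; apply/eqP.
  have : (f^`() * g - f * g^`()) * (f * g) = 0.
    apply: poly_eq0_horner => t; rewrite hornerM.
    have [ft|ft] := eqVneq f.[t] 0; first by rewrite [X in _ * X]hornerM ft mul0r mulr0.
    have [gt|gt] := eqVneq g.[t] 0; first by rewrite [X in _ * X]hornerM gt !mulr0.
    by rewrite hornerD hornerN !hornerM h // subrr mul0r.
  move=> /eqP; rewrite mulf_eq0 => /orP[/eqP //|].
  by rewrite mulf_eq0 (negPf (nz f f0)) (negPf (nz g _)) // -fg0.
apply/eqP; rewrite -subr_eq0; apply/negPn/negP => d0.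
pose d := f - g; have dE : d^`() * g = d * g^`().
  by rewrite /d derivB !mulrBl E [g^`() * g]mulrC.
(* If d = q X^k with q(0) <> 0, then k > 0 since d(0) = 0, and the coefficient of
   X^(k-1) in d' g = d g' gives k q(0) g(0) = 0. *)
have [k [q]] := multiplicity_XsubC d 0; rewrite d0 /= subr0 => q0 dk.
have g0 : g.[0] != 0 by rewrite -fg0.
case: k dk => [|k] dk.
  have dq : d = q by rewrite dk expr0 mulr1.
  by move: q0; rewrite /root -dq /d hornerD hornerN fg0 subrr eqxx.
have : (q^`() * 'X + q *+ k.+1) * g = q * 'X * g^`().
  apply: (@mulIf _ ('X ^+ k)); first by rewrite expf_neq0 // polyX_eq0.
  rewrite -[RHS]mulrAC -[q * 'X * _]mulrA -exprS -dk -dE dk derivM derivXn /=.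
  rewrite exprS -(mulr_natr q) -(mulr_natr ('X ^+ k)).
  move: (k.+1%:R) (q^`()) ('X^k) => a b c; ring.
move=> /(congr1 (horner^~ 0)); rewrite !hornerM hornerD !hornerM hornerX.
rewrite !mulr0 !mul0r add0r hornerMn => /eqP; rewrite mulf_eq0 (negPf g0) orbF mulrn_eq0 /=.
by move: q0; rewrite /root => /negPf ->.
Qed.

(** Multiplication on the right by the matrix K of the columns of T^T and N^T makes
    both determinants block triangular. Below, T is a tangent frame, N a normal frame
    and D the derivative of a normal field, so that - D T^T is the matrix of its
    shape form. *)
Lemma det_orthogonal_split p m (T : 'M[R]_(p, p + m)) (N : 'M[R]_(m, p + m)) :
  row_free T -> row_free N -> T *m N^T = 0 ->
  exists2 c, c != 0 & forall D : 'M[R]_(p, p + m),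
    \det (col_mx (T + D) N) = c * \det (T *m T^T + D *m T^T) /\
    \det (col_mx (T - D) (- N)) = (-1) ^+ m * c * \det (T *m T^T - D *m T^T).
Proof.
move=> fT fN TN; pose K : 'M[R]_(p + m) := row_mx T^T N^T.
have NT : N *m T^T = 0 by rewrite -[LHS]trmxK trmx_mul trmxK TN trmx0.
have uT := gram_unitmx fT; have uN := gram_unitmx fN.
have kK : \det K != 0.
  have : K^T *m K \in unitmx.
    rewrite /K tr_row_mx !trmxK mul_col_row TN NT unitmxE det_ublock unitrM.
    by rewrite -!unitmxE uT uN.
  by rewrite unitmx_mul => /andP[_]; rewrite unitmxE unitfE.
have nN : \det (N *m N^T) != 0 by move: uN; rewrite unitmxE unitfE.
exists (\det (N *m N^T) / \det K); first by rewrite mulf_neq0 ?invr_eq0.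
move=> D; split; apply: (mulIf kK); rewrite -det_mulmx /K mul_col_row.
  rewrite NT det_ublock mulmxDl mulrAC divfK // mulrC //.
rewrite !mulNmx NT oppr0 det_ublock mulmxBl detN.
move: kK; rewrite /K.
move: (\det (row_mx _ _)) (\det (N *m _)) ((-1) ^+ m) (\det (_ - _)) => b a c d b0.
by field.
Qed.

Lemma det_pencil p (G B : 'M[R]_p) :
  exists f : {poly R}, forall t, f.[t] = \det (G + t *: B).
Proof.
exists (\det (map_mx polyC G + 'X *: map_mx polyC B)) => t.
rewrite -horner_evalE -det_map_mx; congr (\det _); apply/matrixP => i j.
by rewrite !mxE /= /horner_eval hornerD hornerM !hornerC hornerX.
Qed.

Lemma mulmx_sym_swap p n (T D : 'M[R]_(p, n)) (x y : 'rV[R]_p) :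
  (D *m T^T)^T = D *m T^T -> (x *m T) *m (y *m D)^T = (x *m D) *m (y *m T)^T.
Proof.
move=> sym; rewrite !trmx_mul -!mulmxA; congr (_ *m _); rewrite !mulmxA; congr (_ *m _).
by rewrite -sym trmx_mul trmxK.
Qed.

Lemma linear_rV_mulmx k n (L : {linear 'rV[R]_k -> 'rV[R]_n}) x :
  L x = x *m \matrix_(i < k) L (delta_mx 0 i).
Proof.
rewrite mulmx_sum_row {1}(row_sum_delta x) linear_sum.
by apply: eq_bigr => i _; rewrite linearZ rowK.
Qed.

(** The hypothesis makes the rows of Xi A and Xi B dual to each other up to the signs
    eps, so the left-hand side is the trace of C A^-1 computed in that frame: the
    logarithmic derivative of det A if C is the derivative of A. *)
Lemma trace_frame_logderiv n (Xi A B C : 'M[R]_n) (eps : 'rV[R]_n) :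
  (forall i, eps 0 i * eps 0 i = 1) -> (Xi *m A) *m (Xi *m B)^T = diag_mx eps ->
  \sum_i eps 0 i * ((Xi *m B) *m (Xi *m C)^T) i i = \tr (C *m \adj A) / \det A.
Proof.
move=> heps AB.
have d1 : diag_mx eps *m diag_mx eps = 1%:M.
  rewrite mulmx_diag -diag_const_mx; congr diag_mx; apply/rowP => j.
  by rewrite !mxE heps.
have AB1 : (Xi *m A) *m ((Xi *m B)^T *m diag_mx eps) = 1%:M by rewrite mulmxA AB.
have AZX : A *m (((Xi *m B)^T *m diag_mx eps) *m Xi) = 1%:M.
  by rewrite (mulmxA A); apply: mulmx1C; rewrite (mulmxA Xi A).
have [uA _] := mulmx1_unit AZX.
have ZX : ((Xi *m B)^T *m diag_mx eps) *m Xi = invmx A.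
  by rewrite -[LHS](mulKmx uA) AZX mulmx1.
transitivity (\tr (diag_mx eps *m ((Xi *m B) *m (Xi *m C)^T))).
  apply: eq_bigr => i _; by rewrite mul_diag_mx !mxE.
rewrite -mxtrace_tr trmx_mul tr_diag_mx trmx_mul trmxK -mulmxA.
rewrite -mulmxA mxtrace_mulC -mulmxA ZX /invmx uA -scalemxAr mxtraceZ.
by rewrite mulrC.
Qed.

End RealMatrices.

(** * Directional derivatives and Jacobi's formula *)

Section Deriv.
Variable R : realType.

Lemma is_derive_lin (V E F : normedModType R) (L : {linear E -> F}) (f : V -> E)
    x v df : continuous L -> is_derive x v f df ->
  is_derive x v (L \o f) (L df).
Proof.
move=> cL [dfx <-].
have h : (fun h : R => h^-1 *: (((L \o f) \o shift x) (h *: v) - (L \o f) x)) @ 0^'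
    --> L ('D_v f x).
  have -> : (fun h : R => h^-1 *: (((L \o f) \o shift x) (h *: v) - (L \o f) x)) =
     L \o (fun h : R => h^-1 *: ((f \o shift x) (h *: v) - f x)).
    by apply: eq_fun => h /=; rewrite linearZZ [L (_ - _)]linearB.
  by apply: cvg_comp dfx _; apply: cL.
split; first by apply/cvg_ex; eexists; exact: h.
exact: cvg_lim h.
Qed.

Lemma is_derive_line (V E : normedModType R) (f : V -> E) (u v : V) df :
  is_derive u v f df <-> is_derive (0 : R) 1 (fun t : R => f (t *: v + u)) df.
Proof.
have e : (fun h : R => h^-1 *:
     (((fun t : R => f (t *: v + u)) \o shift 0) (h *: 1) - f (0 *: v + u))) =
   (fun h : R => h^-1 *: ((f \o shift u) (h *: v) - f u)).
  apply: eq_fun => h /=; rewrite scale0r add0r addr0.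
  by rewrite /GRing.scale /= mulr1.
by split=> -[d <-]; split; rewrite /derivable /derive ?e // -?e.
Qed.

Lemma is_derive_coord (V : normedModType R) n (f : V -> 'rV[R]_n) x v df j :
  is_derive x v f df -> is_derive x v (fun t => f t 0 j) (df 0 j).
Proof.
move=> [d <-]; split; first exact: (derivable_mxP _ _ _).1.
by rewrite derive_mx // mxE.
Qed.

Lemma is_derive_rV (V : normedModType R) n (f : V -> 'rV[R]_n) x v (df : 'rV[R]_n) :
  (forall j, is_derive x v (fun t => f t 0 j) (df 0 j)) -> is_derive x v f df.
Proof.
move=> h; have d : derivable f x v.
  by apply/derivable_mxP => i j; rewrite ord1; have [] := h j.
split=> //; rewrite derive_mx //; apply/rowP => j; rewrite mxE.
by have [_ ->] := h j.
Qed.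

Lemma is_derive_pair (V E F : normedModType R) (f : V -> E) (h : V -> F) x v df dh :
  is_derive x v f df -> is_derive x v h dh ->
  is_derive x v (fun t => (f t, h t) : (E * F)%type) (df, dh).
Proof.
move=> [cf <-] [ch <-].
have c : (fun t : R => t^-1 *:
      (((fun t => (f t, h t) : (E * F)%type) \o shift x) (t *: v) - (f x, h x))) @ 0^'
    --> ('D_v f x, 'D_v h x).
  exact: cvg_pair cf ch.
split; first by apply/cvg_ex; eexists; exact: c.
exact: cvg_lim c.
Qed.

Lemma is_derive_sum_seq (V E : normedModType R) (I : Type) (r : seq I)
    (F : I -> V -> E) (dF : I -> E) x v :
  (forall i, is_derive x v (F i) (dF i)) ->
  is_derive x v (fun t => \sum_(i <- r) F i t) (\sum_(i <- r) dF i).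
Proof.
move=> h; elim: r => [|i r IH].
  under eq_fun do rewrite big_nil; rewrite big_nil; exact: is_derive_cst.
under eq_fun do rewrite big_cons; rewrite big_cons.
exact: (is_deriveD (h i) IH).
Qed.

Lemma is_derive_prod_ord (V : normedModType R) n (f : 'I_n -> V -> R) (df : 'I_n -> R) x v :
  (forall i, is_derive x v (f i) (df i)) ->
  is_derive x v (fun t => \prod_(i < n) f i t)
    (\sum_(i < n) \prod_(j < n) if j == i then df j else f j x).
Proof.
elim: n f df => [|n IH] f df h.
  under eq_fun do rewrite big_ord0; rewrite big_ord0; exact: is_derive_cst.
under eq_fun do rewrite big_ord_recr /=.
have IH' := IH _ _ (fun i => h (widen_ord (leqnSn n) i)).
have IM := is_deriveM IH' (h ord_max).
apply: (is_derive_eq IM).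
rewrite big_ord_recr /= big_ord_recr /= eqxx addrC; congr (_ + _).
  rewrite /GRing.scale /=; congr (_ * _); apply: eq_bigr => j _.
  by rewrite -val_eqE /= ltn_eqF.
rewrite /GRing.scale /= mulr_sumr; apply: eq_bigr => i _.
rewrite big_ord_recr /= mulrC; congr (_ * _).
by rewrite -val_eqE /= gtn_eqF.
Qed.

(** Differentiating row by row, and expanding each determinant along the
    differentiated row, produces the cofactors. *)
Lemma is_derive_det (V : normedModType R) n (M : V -> 'M[R]_n) (dM : 'M[R]_n) x v :
  (forall i j, is_derive x v (fun t => M t i j) (dM i j)) ->
  is_derive x v (fun t => \det (M t)) (\tr (dM *m \adj (M x))).
Proof.
move=> h; rewrite /determinant.
have h1 (s : 'S_n) : is_derive x v (fun t => (-1) ^+ s * \prod_(i < n) M t i (s i))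
   ((-1) ^+ s * \sum_(i < n) \prod_(j < n) if j == i then dM j (s j) else M x j (s j)).
  exact: is_deriveZ (is_derive_prod_ord (fun i => h i (s i))).
apply: (is_derive_eq (is_derive_sum_seq (index_enum _) h1)).
under eq_bigr do rewrite mulr_sumr.
rewrite exchange_big /=; apply: eq_bigr => i _.
pose Mi := \matrix_(k, l) if k == i then dM k l else M x k l.
transitivity (\det Mi).
  apply: eq_bigr => s _; congr (_ * _); apply: eq_bigr => k _; by rewrite !mxE.
rewrite (expand_det_row _ i) mxE; apply: eq_bigr => j _.
rewrite !mxE eqxx; congr (_ * _).
rewrite /cofactor; congr (_ * \det _); apply/matrixP => a b; rewrite !mxE.
by rewrite eq_sym (negPf (neq_lift _ _)).
Qed.

Lemma linear_rV_continuous n (E : normedModType R) (L : {linear 'rV[R]_n -> E}) :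
  continuous L.
Proof.
have -> : (L : _ -> _) = fun x => \sum_(j < n) x 0 j *: L (delta_mx 0 j).
  apply/funext => x; rewrite {1}(row_sum_delta x) linear_sum.
  by apply: eq_bigr => j _; rewrite linearZ.
elim: (index_enum _) => [|j r IH].
  by under eq_fun do rewrite big_nil; exact: cst_continuous.
under eq_fun do rewrite big_cons.
have cj : continuous (fun x : 'rV[R]_n => x 0 j *: L (delta_mx 0 j)).
  move=> x; apply: (@continuous_comp _ _ _
    (fun y : 'rV[R]_n => y 0 j) ( *:%R^~ (L (delta_mx 0 j)))).
    exact: coord_continuous.
  exact: scalel_continuous.
by move=> x; apply: (@continuousD _ _ _ _ _ x (cj x) (IH x)).
Qed.

Lemma row_mx_continuous p m :
  continuous (fun z : 'rV[R]_p * 'rV[R]_m => row_mx z.1 z.2 : 'rV[R]_(p + m)).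
Proof.
have lL : linear (fun x : 'rV[R]_p => row_mx x 0 : 'rV[R]_(p + m)).
  by move=> a x y; rewrite scale_row_mx add_row_mx scaler0 addr0.
have lR : linear (fun x : 'rV[R]_m => row_mx 0 x : 'rV[R]_(p + m)).
  by move=> a x y; rewrite scale_row_mx add_row_mx scaler0 addr0.
pose LM := GRing.isLinear.Build _ _ _ _ _ lL.
pose L : {linear 'rV[R]_p -> 'rV[R]_(p + m)} :=
  HB.pack (fun x : 'rV[R]_p => row_mx x 0 : 'rV[R]_(p + m)) LM.
pose RM := GRing.isLinear.Build _ _ _ _ _ lR.
pose S : {linear 'rV[R]_m -> 'rV[R]_(p + m)} :=
  HB.pack (fun x : 'rV[R]_m => row_mx 0 x : 'rV[R]_(p + m)) RM.
have -> : (fun z : 'rV[R]_p * 'rV[R]_m => row_mx z.1 z.2) = (L \o fst) \+ (S \o snd).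
  by apply/funext => z /=; rewrite add_row_mx addr0 add0r.
move=> z; apply: continuousD.
  apply: continuous_comp; first exact: cvg_fst.
  exact: linear_rV_continuous.
apply: continuous_comp; first exact: cvg_snd.
exact: linear_rV_continuous.
Qed.

End Deriv.

(** * Maps of class C^k *)

Section DiffNear.
Variable R : realType.

Lemma near_differentiable (V W : normedModType R) (f g : V -> W) (x : V) :
  (\near x, f x = g x) -> differentiable f x -> differentiable g x.
Proof.
move=> fg df; have fgx := nbhs_singleton fg.
have e : g \o shift x = cst (g x) + 'd f x +o_ 0 id.
  apply/eqaddoP => eps eps0.
  have /eqaddoP /(_ eps eps0) := diff_locally df.
  have fg0 : \forall y \near (0 : V), f (y + x) = g (y + x).
    by move: fg; rewrite (near_shift 0) /=; apply: filterS => y; rewrite subr0.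
  apply: filterS2 fg0 => y fgy.
  rewrite -[(f \o shift x - _) y]/(f (y + x) - (f x + 'd f x y)).
  by rewrite -[(g \o shift x - _) y]/(g (y + x) - (g x + 'd f x y)) fgy fgx.
apply/diff_locallyP; have -> : 'd g x = 'd f x :> (V -> W).
  by apply: diff_unique => //; exact: diff_continuous.
by split => //; exact: diff_continuous.
Qed.

End DiffNear.

Section CkTheory.
Variables (R : realType) (k : nat).
Implicit Types (V : set 'rV[R]_k).

Lemma open_near V u (P : 'rV[R]_k -> Prop) : open V -> V u -> (forall w, V w -> P w) ->
  \forall w \near u, P w.
Proof. by move=> oV Vu VP; apply: filterS VP _; apply: open_nbhs_nbhs. Qed.

(** On an open set, the derivative at a point only depends on the values of the map
    on the set. *)
Lemma Ck_ext (E : normedModType R) m V (f g : 'rV[R]_k -> E) : open V ->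
  (forall u, V u -> f u = g u) -> Ck m V f -> Ck m V g.
Proof.
move=> oV; elim: m f g => [|m IH] f g fg /=.
  move=> cf u Vu; suff : g @ u --> g u by []; rewrite -(fg u Vu).
  have e : \forall w \near u, f w = g w by exact: open_near oV Vu fg.
  exact: cvg_trans (near_eq_cvg e) (cf u Vu).
move=> [df dDf]; split=> [u Vu|v].
  apply: near_differentiable (df u Vu); exact: open_near oV Vu fg.
apply: IH (dDf v) => u Vu; apply: near_eq_derive.
exact: open_near oV Vu fg.
Qed.

Lemma CkS (E : normedModType R) m V (f : 'rV[R]_k -> E) : Ck m.+1 V f ->
  (forall u, V u -> differentiable f u) /\ (forall v, Ck m V (fun u => 'D_v f u)).
Proof. by []. Qed.

Lemma CkW (E : normedModType R) m V (f : 'rV[R]_k -> E) : Ck m.+1 V f -> Ck m V f.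
Proof.
elim: m f => [|m IH] f.
  by move=> [df _] u Vu; apply: differentiable_continuous; apply: df.
by move=> [df dDf]; split=> // v; apply: IH; apply: dDf.
Qed.

Lemma Ck_sub (E : normedModType R) m V V' (f : 'rV[R]_k -> E) : V' `<=` V ->
  Ck m V f -> Ck m V' f.
Proof.
move=> sV; elim: m f => [|m IH] f /=; first by move=> cf u /sV; apply: cf.
by move=> [df dDf]; split=> [u /sV|v]; [apply: df | apply: IH; apply: dDf].
Qed.

Lemma Ck_cst (E : normedModType R) m V (a : E) : Ck m V (fun=> a).
Proof.
elim: m a => [|m IH] a /=; first by move=> u _; apply: cst_continuous.
split=> [u _|v]; first exact: differentiable_cst.
have -> : (fun u => 'D_v (fun=> a) u) = fun=> (0 : E) by apply: eq_fun => u; rewrite derive_cst.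
exact: IH.
Qed.

Lemma Ck_add (E : normedModType R) m V (f g : 'rV[R]_k -> E) : open V ->
  Ck m V f -> Ck m V g -> Ck m V (fun u => f u + g u).
Proof.
move=> oV; elim: m f g => [|m IH] f g /=.
  by move=> cf cg u Vu; apply: continuousD; [apply: cf | apply: cg].
move=> [df dDf] [dg dDg]; split=> [u Vu|v].
  by apply: differentiableD; [apply: df | apply: dg].
apply: (Ck_ext oV _ (IH _ _ (dDf v) (dDg v))) => u Vu.
by rewrite -deriveD //; apply: diff_derivable; [apply: df | apply: dg].
Qed.

Lemma Ck_sum (E : normedModType R) (I : Type) (r : seq I) m V (f : I -> 'rV[R]_k -> E) : open V ->
  (forall i, Ck m V (f i)) -> Ck m V (fun u => \sum_(i <- r) f i u).
Proof.
move=> oV hf; elim: r => [|i r IH].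
  by under eq_fun do rewrite big_nil; apply: Ck_cst.
by under eq_fun do rewrite big_cons; apply: Ck_add.
Qed.

Lemma Ck_lin (E F : normedModType R) (L : {linear E -> F}) m V (f : 'rV[R]_k -> E) : open V ->
  continuous L -> Ck m V f -> Ck m V (L \o f).
Proof.
move=> oV cL; elim: m f => [|m IH] f /=.
  by move=> cf u Vu; apply: continuous_comp; [apply: cf | apply: cL].
move=> [df dDf]; split=> [u Vu|v].
  by apply: differentiable_comp; [apply: df | apply: linear_differentiable].
apply: (Ck_ext oV _ (IH _ (dDf v))) => u Vu /=.
have /derivableP dfu : derivable f u v by apply: diff_derivable; apply: df.
by have [_ ->] := is_derive_lin cL dfu.
Qed.

Lemma Ck_coord n m V (f : 'rV[R]_k -> 'rV[R]_n) j : open V ->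
  Ck m V f -> Ck m V (fun u => f u 0 j).
Proof.
move=> oV hf; pose p (x : 'rV[R]_n) : R := x 0 j.
have e : linear p by move=> a y z; rewrite /p !mxE.
pose LM := GRing.isLinear.Build _ _ _ _ _ e.
pose L : {linear 'rV[R]_n -> R} := HB.pack p LM.
have cL : continuous L by move=> x; exact: coord_continuous.
exact: (Ck_lin oV cL hf).
Qed.

Lemma Ck_mul m V (f g : 'rV[R]_k -> R) : open V ->
  Ck m V f -> Ck m V g -> Ck m V (fun u => f u * g u).
Proof.
move=> oV; elim: m f g => [|m IH] f g.
  by move=> cf cg u Vu; apply: continuousM; [apply: cf | apply: cg].
move=> hf hg; have [df dDf] := CkS hf; have [dg dDg] := CkS hg; split=> [u Vu|v].
  by apply: differentiableM; [apply: df | apply: dg].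
apply: (Ck_ext oV _ (Ck_add oV (IH _ _ (CkW hf) (dDg v)) (IH _ _ (CkW hg) (dDf v)))) => u Vu.
rewrite -[LHS]/(f u *: 'D_v g u + g u *: 'D_v f u).
by rewrite -deriveM //; apply: diff_derivable; [apply: df | apply: dg].
Qed.

Lemma Ck_prod (I : Type) (r : seq I) m V (f : I -> 'rV[R]_k -> R) : open V ->
  (forall i, Ck m V (f i)) -> Ck m V (fun u => \prod_(i <- r) f i u).
Proof.
move=> oV hf; elim: r => [|i r IH].
  by under eq_fun do rewrite big_nil; apply: Ck_cst.
by under eq_fun do rewrite big_cons; apply: Ck_mul.
Qed.

Lemma Ck_inv m V (f : 'rV[R]_k -> R) : open V -> (forall u, V u -> f u != 0) ->
  Ck m V f -> Ck m V (fun u => (f u)^-1).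
Proof.
move=> oV f0; elim: m => [|m IH].
  by move=> cf u Vu; apply: continuousV; [apply: f0 | apply: cf].
move=> hf; have [df dDf] := CkS hf; split=> [u Vu|v].
  by apply: differentiableV; [apply: df | apply: f0].
have hi := IH (CkW hf).
have h : Ck m V (fun u => (-1) * ((f u)^-1 * (f u)^-1 * 'D_v f u)).
  apply: Ck_mul => //; first exact: Ck_cst.
  by apply: Ck_mul => //; apply: Ck_mul.
apply: (Ck_ext oV _ h) => u Vu.
rewrite deriveV ?f0 //; last by apply: diff_derivable; apply: df.
by rewrite /GRing.scale /= mulN1r mulNr -expr2 exprVn.
Qed.

Lemma Ck_det n m V (M : 'rV[R]_k -> 'M[R]_n) : open V ->
  (forall i j, Ck m V (fun u => M u i j)) -> Ck m V (fun u => \det (M u)).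
Proof.
move=> oV hM; apply: Ck_sum => // s; apply: Ck_mul => //; first exact: Ck_cst.
exact: Ck_prod.
Qed.

(** Cramer's rule. *)
Lemma Ck_invmx n m V (M : 'rV[R]_k -> 'M[R]_n) : open V ->
  (forall u, V u -> M u \in unitmx) ->
  (forall i j, Ck m V (fun u => M u i j)) -> forall i j, Ck m V (fun u => invmx (M u) i j).
Proof.
move=> oV uM hM i j.
have h : Ck m V (fun u => (\det (M u))^-1 * ((-1) ^+ (j + i) * \det (row' j (col' i (M u))))).
  apply: Ck_mul => //.
    apply: Ck_inv => //; last exact: Ck_det.
    by move=> u /uM; rewrite unitmxE unitfE.
  apply: Ck_mul => //; first exact: Ck_cst.
  apply: Ck_det => // a b; have := hM (lift j a) (lift i b).
  by under [X in _ -> Ck _ _ X]eq_fun do rewrite !mxE.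
by apply: (Ck_ext oV _ h) => u Vu; rewrite /invmx uM // !mxE.
Qed.

Lemma Ck_rV n m V (f : 'rV[R]_k -> 'rV[R]_n) : open V ->
  (forall j, Ck m V (fun u => f u 0 j)) -> Ck m V f.
Proof.
move=> oV hf.
have h : Ck m V (fun u => \sum_(j < n) f u 0 j *: (delta_mx 0 j : 'rV[R]_n)).
  apply: Ck_sum => // j.
  have e : linear ( *:%R ^~ (delta_mx 0 j : 'rV[R]_n) : R -> _).
    by move=> a y z; rewrite scalerDl scalerA.
  pose LM := GRing.isLinear.Build _ _ _ _ _ e.
  pose L : {linear R -> 'rV[R]_n} := HB.pack ( *:%R ^~ (delta_mx 0 j : 'rV[R]_n)) LM.
  exact: (@Ck_lin _ _ L m V _ oV (@scalel_continuous _ _ _) (hf j)).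
by apply: (Ck_ext oV _ h) => u Vu; rewrite -row_sum_delta.
Qed.

Lemma Ck_pair (E F : normedModType R) m V (f : 'rV[R]_k -> E) (g : 'rV[R]_k -> F) : open V ->
  Ck m V f -> Ck m V g -> Ck m V (fun u => (f u, g u) : (E * F)%type).
Proof.
move=> oV; elim: m f g => [|m IH] f g /=.
  by move=> cf cg u Vu; exact: cvg_pair (cf u Vu) (cg u Vu).
move=> [df dDf] [dg dDg]; split=> [u Vu|v].
  by apply: differentiable_pair; [apply: df | apply: dg].
apply: (Ck_ext oV _ (IH _ _ (dDf v) (dDg v))) => u Vu.
have [hf hg] := (df u Vu, dg u Vu).
rewrite [RHS]deriveE; last exact: differentiable_pair.
by rewrite diff_pair // !deriveE.
Qed.

Lemma Ck_linear (E : normedModType R) (L : {linear 'rV[R]_k -> E}) m V : Ck m V L.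
Proof.
have cL : continuous L by exact: linear_rV_continuous.
case: m => [|m]; first by move=> u _; exact: cL.
split=> [u _|v]; first exact: linear_differentiable.
have -> : (fun u => 'D_v L u) = fun=> L v.
  by apply: eq_fun => u; rewrite deriveE ?diff_lin //; exact: linear_differentiable.
exact: Ck_cst.
Qed.

End CkTheory.

Lemma Ck_pre (R : realType) (k l : nat) (E : normedModType R)
    (L : {linear 'rV[R]_l -> 'rV[R]_k}) m (V : set 'rV[R]_k) (f : 'rV[R]_k -> E) :
  open V -> Ck m V f -> Ck m (L @^-1` V) (f \o L).
Proof.
move=> oV; have cL : continuous L by exact: linear_rV_continuous.
have oV' : open (L @^-1` V) by apply: open_comp => // w _; apply: cL.
elim: m f => [|m IH] f /=.
  by move=> cf u Vu; apply: continuous_comp; [apply: cL | apply: cf].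
move=> [df dDf]; split=> [u Vu|v].
  by apply: differentiable_comp; [apply: linear_differentiable | apply: df].
apply: (Ck_ext oV' _ (IH _ (dDf (L v)))) => u Vu /=.
have dfu : differentiable f (L u) by apply: df.
have dL : differentiable L u by apply: linear_differentiable.
rewrite [RHS]deriveE; last exact: differentiable_comp.
by rewrite diff_comp // deriveE //= diff_lin.
Qed.

(** * Symmetry of second derivatives *)

Section Schwarz.
Variable R : realType.

Lemma differentiable_near_bound (V W : normedModType R) (f : V -> W) x (eps : R) :
  differentiable f x -> 0 < eps ->
  \forall y \near (0 : V), `|f (y + x) - f x - 'd f x y| <= eps * `|y|.
Proof.
move=> df eps0; have /eqaddoP /(_ eps eps0) := diff_locally df.
apply: filterS => y.
by rewrite -[(f \o shift x - _) y]/(f (y + x) - (f x + 'd f x y)) opprD addrA.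
Qed.

Lemma is_derive_chain (V W : normedModType R) (f : V -> W) (c : R -> V) (x : R) dc :
  differentiable f (c x) -> is_derive x (1 : R) c dc ->
  is_derive x (1 : R) (fun t => f (c t)) ('d f (c x) dc).
Proof.
move=> df [/derivable1_diffP dcx <-].
have dfc : differentiable (f \o c) x by exact: differentiable_comp.
split; first exact/diff_derivable.
by rewrite (deriveE _ dfc) diff_comp // deriveE.
Qed.

Lemma is_derive_affine (V : normedModType R) (v y : V) (s : R) :
  is_derive s (1 : R) (fun s : R => s *: v + y) v.
Proof.
have -> : (fun s : R => s *: v + y) = ( *:%R^~ v) + cst y by [].
rewrite -[X in is_derive _ _ _ X]addr0; apply: is_deriveD.
have dv : differentiable ( *:%R^~ v : R -> V) s by exact: ex_diff.
split; first exact/diff_derivable.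
by rewrite deriveE // diff_val scale1r.
Qed.

(** By the mean value theorem in the direction v, the second difference is t times an
    increment of the derivative along v, which the differentiability of that
    derivative at u evaluates up to o(t). *)
Lemma second_difference k (V : set 'rV[R]_k) (f : 'rV[R]_k -> R) (u v w : 'rV[R]_k) (eps : R) :
  open V -> V u -> Ck 2 V f -> 0 < eps ->
  exists2 d, 0 < d & forall t, 0 < t < d ->
    `|f (t *: v + t *: w + u) - f (t *: v + u) - f (t *: w + u) + f u
      - t ^+ 2 * 'D_w (fun y => 'D_v f y) u| <= eps * t ^+ 2.
Proof.
move=> oV Vu /CkS[df /(_ v) /CkS[dDf _]] eps0.
pose h y := 'D_v f y; have dh : differentiable h u by exact: dDf.
(* The two displacements from u that occur have sum of norms at most t K. *)
pose K := 2 * `|v| + `|w| + 1.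
have K0 : 0 < K by rewrite /K; apply: ltr_wpDl => //; rewrite addr_ge0 // mulr_ge0.
have e'0 : 0 < eps / K by rewrite divr_gt0.
have near0 : \forall y \near (0 : 'rV[R]_k), V (y + u) /\
     `|h (y + u) - h u - 'd h u y| <= eps / K * `|y|.
  apply: filterI; last exact: (differentiable_near_bound dh e'0).
  have : \near u, V u by apply: open_nbhs_nbhs.
  by rewrite (near_shift 0) /=; apply: filterS => y; rewrite subr0.
have /nbhs_norm0P[r /= r0 hr] := near0.
exists (r / K); first exact: divr_gt0.
move=> t /andP[t0]; rewrite ltr_pdivlMr // => tK.
have small s b : 0 <= s <= t -> 0 <= b <= t -> `|s *: v + b *: w| < r.
  move=> /andP[s0 st] /andP[b0 bt]; apply: le_lt_trans tK.
  rewrite (le_trans (ler_normD _ _)) // !normrZ !ger0_norm // /K.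
  have := normr_ge0 v; have := normr_ge0 w; nra.
pose G s := f (s *: v + t *: w + u) - f (s *: v + u).
pose dG s := h (s *: v + t *: w + u) - h (s *: v + u).
have dGP s : 0 <= s <= t -> is_derive s 1 G (dG s).
  move=> st; have t01 : 0 <= t <= t by rewrite lexx ltW.
  have dline y : V (s *: v + y) ->
      is_derive s (1 : R) (fun s : R => f (s *: v + y)) (h (s *: v + y)).
    move=> Vy; have dfy := df _ Vy; rewrite /h deriveE //.
    exact: (is_derive_chain (c := fun s : R => s *: v + y) dfy (is_derive_affine v y s)).
  have V1 : V (s *: v + (t *: w + u)).
    by rewrite addrA; apply: (hr _ _).1; rewrite /= small.
  have V2 : V (s *: v + u).
    rewrite -[s *: v]addr0 -(scale0r w); apply: (hr _ _).1.
    by rewrite /= small // lexx ltW.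
  have := is_deriveB (dline _ V1) (dline _ V2).
  by rewrite addrA; under eq_fun do rewrite addrA.
have [s /[!in_itv] /andP[s0 st] Gs] : exists2 s, s \in `]0, t[ & G t - G 0 = dG s * (t - 0).
  apply: MVT => // [s|].
    rewrite in_itv /= => /andP[s0 st]; apply: dGP; by rewrite !ltW.
  apply: derivable_within_continuous => s; rewrite in_itv /= => st.
  by have [] := dGP s st.
have -> : f (t *: v + t *: w + u) - f (t *: v + u) - f (t *: w + u) + f u = dG s * t.
  move: Gs; rewrite subr0 /G scale0r !add0r => <-.
  by rewrite opprB addrA addrAC.
rewrite deriveE // -/h.
have s01 : 0 <= s <= t by rewrite !ltW.
have t01 : 0 <= t <= t by rewrite lexx ltW.
have z01 : 0 <= (0 : R) <= t by rewrite lexx ltW.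
have b1 := (hr _ (small s t s01 t01)).2.
have b2 := (hr _ (small s 0 s01 z01)).2.
rewrite scale0r addr0 in b2.
set L := 'd h u in b1 b2 *.
have -> : dG s * t - t ^+ 2 * L w =
    t * ((h (s *: v + t *: w + u) - h u - L (s *: v + t *: w)) -
         (h (s *: v + u) - h u - L (s *: v))).
  rewrite [L (_ + _)]linearD [L (t *: w)]linearZ /= /dG.
  by move: (h _) (h (s *: v + u)) (h u) (L w) (L _); rewrite /GRing.scale /= => a b c d e; ring.
rewrite normrM gtr0_norm // [_ * t ^+ 2]mulrC expr2 -mulrA ler_pM2l //.
apply: le_trans (ler_normB _ _) _; apply: le_trans (lerD b1 b2) _.
rewrite -mulrDr mulrAC ler_pdivrMr // mulrC -[leRHS]mulrA [leRHS]mulrCA [leRHS]mulrC.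
rewrite -[leRHS]mulrA ler_pM2l // /K.
have e1 : `|s *: v + t *: w| <= t * `|v| + t * `|w|.
  rewrite (le_trans (ler_normD _ _)) // !normrZ !gtr0_norm // lerD2r ler_wpM2r // ltW //.
have e2 : `|s *: v| <= t * `|v| by rewrite normrZ gtr0_norm // ler_wpM2r // ltW.
apply: le_trans (lerD e1 e2) _.
have : 0 <= t by exact: ltW.
have := normr_ge0 v; have := normr_ge0 w; nra.
Qed.

(** The second difference is symmetric in v and w, so both iterated derivatives are
    the limit of its quotient by t^2. *)
Lemma Schwarz_scalar k (V : set 'rV[R]_k) (f : 'rV[R]_k -> R) (u v w : 'rV[R]_k) :
  open V -> V u -> Ck 2 V f ->
  'D_v (fun y => 'D_w f y) u = 'D_w (fun y => 'D_v f y) u.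
Proof.
move=> oV Vu cf; apply/eqP; rewrite -subr_eq0 -normr_le0.
apply/ler_addgt0Pl => eps eps0; rewrite addr0.
have e20 : 0 < eps / 2 by rewrite divr_gt0.
have [d1 d10 n1] := second_difference v w oV Vu cf e20.
have [d2 d20 n2] := second_difference w v oV Vu cf e20.
pose t := Num.min d1 d2 / 2.
have m0 : 0 < Num.min d1 d2 by rewrite lt_min d10.
have t0 : 0 < t by rewrite divr_gt0.
have tm : t < Num.min d1 d2 by rewrite ltr_pdivrMr // ltr_pMr // ltr1n.
have [td1 td2] : t < d1 /\ t < d2 by move: tm; rewrite lt_min => /andP.
have := n1 t; rewrite t0 td1 => /(_ isT) h1.
have := n2 t; rewrite t0 td2 => /(_ isT) h2.
rewrite [t *: w + t *: v]addrC in h2.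
move: h1 h2; move: (f _) (f (t *: v + u)) (f (t *: w + u)) (f u) ('D_v _ u) ('D_w _ u).
move=> a b c d x y h1 h2.
have t20 : 0 < t ^+ 2 by rewrite exprn_gt0.
rewrite -(ler_pM2l t20) -[X in X * _](gtr0_norm t20) -normrM.
have -> : t ^+ 2 * (x - y) = (a - b - c + d - t ^+ 2 * y) - (a - c - b + d - t ^+ 2 * x) by ring.
apply: le_trans (ler_normB _ _) _; apply: le_trans (lerD h1 h2) _.
by rewrite -mulrDl -splitr mulrC.
Qed.

End Schwarz.

(** * Change of charts *)

Section Curves.
Variable R : realType.

Lemma is_derive_eps (V : normedModType R) (f : R -> V) df :
  (forall eps, 0 < eps -> \forall h \near (0 : R), `|f h - f 0 - h *: df| <= eps * `|h|) ->
  is_derive (0 : R) (1 : R) f df.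
Proof.
move=> hf.
have h : (fun h : R => h^-1 *: ((f \o shift 0) (h *: 1) - f 0)) @ 0^' --> df.
  apply/cvgrPdist_le => eps eps0.
  near=> h.
  have h0 : h != 0 by near: h; exact: nbhs_dnbhs_neq.
  rewrite distrC /= addr0 [h *: 1]mulr1.
  rewrite -[df](scalerK h0) -scalerBr normrZ normfV mulrC ler_pdivrMr ?normr_gt0 //.
  by near: h; apply: nbhs_dnbhs; exact: hf.
split; first by apply/cvg_ex; eexists; exact: h.
exact: cvg_lim h.
Unshelve. all: by end_near. Qed.

End Curves.

Lemma chart_restrict (R : realType) (E : normedModType R) k (M : set E) (V V' : set 'rV[R]_k) phi :
  chart M V phi -> open V' -> V' `<=` V -> chart M V' phi.
Proof.
move=> [oV s inj sinj [sub hO]] oV' sub'; split=> //.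
- by move=> j; apply: Ck_sub sub' (s j).
- by move=> u /sub'; apply: inj.
- by move=> x y; rewrite !inE => /sub' Vx /sub' Vy; apply: sinj; rewrite inE.
- split; first by move=> _ [u /sub' Vu <-]; apply: sub; exists u.
  by move=> W oW WV'; apply: hO => // x /WV' /sub'.
Qed.

Section Transition.
Variables (R : realType) (E : normedModType R) (N : nat) (iota : {linear E -> 'rV[R]_N}).
Hypothesis iota_cont : continuous iota.
Hypothesis iota_inj : injective iota.
Variables (k : nat) (M : set E).

(** Through iota the pseudo-inverse of matrices becomes available. *)
Lemma linear_left_inverse (f : {linear 'rV[R]_k -> E}) : injective f ->
  exists L : {linear E -> 'rV[R]_k}, continuous L /\ forall x, L (f x) = x.
Proof.
move=> fi; pose A := lin1_mx (iota \o f).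
have Af : row_free A.
  apply/row_freeP; exists (pinvmx A); apply: mulmxVp.
  rewrite -kermx_eq0; apply/eqP/row_matrixP => i; rewrite row0; set x := row i _.
  have : x *m A = 0 by apply: sub_kermxP; rewrite row_sub.
  rewrite mul_rV_lin1 /= => h; apply: fi; apply: iota_inj.
  by rewrite h !linear0.
exists [the {linear E -> 'rV[R]_k} of mulmxr (pinvmx A) \o iota]; split.
  move=> x; apply: continuous_comp; first exact: iota_cont.
  exact: linear_rV_continuous.
by move=> x /=; rewrite -[iota (f x)](mul_rV_lin1 (iota \o f)) -/A -mulmxA mulmxVp // mulmx1.
Qed.

(** Continuity of the inverse of a chart. *)
Lemma chart_open V phi (u : 'rV[R]_k) (B : set 'rV[R]_k) : chart M V phi -> V u -> nbhs u B ->
  exists2 U : set E, nbhs (phi u) U & forall x, U x -> M x -> exists2 w, V w /\ B w & phi w = x.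
Proof.
move=> [oV _ _ _ [_ hO]] Vu uB.
pose W := (V `&` B)°.
have WV : W `<=` V by move=> w /interior_subset[].
have Wu : W u by apply: filterI => //; apply: open_nbhs_nbhs.
have [U oO e] := hO W (@open_interior _ _) WV.
have : (U `&` M) (phi u) by rewrite -e; exists u.
move=> [Ou _]; exists U; first exact: open_nbhs_nbhs.
move=> x Ox Mx; have : (phi @` W) x by rewrite e.
by move=> [w /interior_subset Ww <-]; exists w.
Qed.

(** The line through u1 is read in the second chart as a curve c. A chart is a
    homeomorphism onto its image, so c is continuous at 0; a left inverse L of the
    differential of phi2 at u2 then bounds c t - u2 by a multiple of t and yields the
    derivative of c. This makes tangent spaces independent of the chart and lets
    fields given in different charts be compared along a curve. *)
Lemma chart_transition V1 phi1 V2 phi2 (u1 u2 xi : 'rV[R]_k) :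
  chart M V1 phi1 -> chart M V2 phi2 -> V1 u1 -> V2 u2 -> phi1 u1 = phi2 u2 ->
  exists (c : R -> 'rV[R]_k) eta,
    [/\ c 0 = u2,
        \forall t \near (0 : R), V2 (c t) /\ phi2 (c t) = phi1 (t *: xi + u1),
        is_derive (0 : R) (1 : R) c eta & 'd phi2 u2 eta = 'd phi1 u1 xi].
Proof.
move=> ch1 ch2 V1u1 V2u2 q12.
have [oV1 s1 _ _ [M1 _]] := ch1; have [oV2 s2 inj2 sinj2 _] := ch2.
have d1 : differentiable phi1 u1 by have [h _] := s1 1%N; exact: h.
have d2 : differentiable phi2 u2 by have [h _] := s2 1%N; exact: h.
pose C t := [set w | V2 w /\ phi2 w = phi1 (t *: xi + u1)].
pose c t := xget u2 (C t).
have inj2' w w' : V2 w -> V2 w' -> phi2 w = phi2 w' -> w = w'.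
  by move=> a b; apply: sinj2; rewrite inE.
have cE t w : V2 w -> phi2 w = phi1 (t *: xi + u1) -> c t = w.
  move=> Vw e; have [] : C t (c t) by apply: (@xgetPex _ u2); exists w.
  by move=> Vc ec; apply: inj2' => //; rewrite ec.
have c0 : c 0 = u2 by apply: cE => //; rewrite scale0r add0r.
have line0 : (fun t : R => t *: xi + u1) @ 0 --> u1.
  have := (@is_derive_affine R _ xi u1 0); move=> [/derivable1_diffP h _].
  have -> : nbhs u1 = nbhs (0 *: xi + u1) by rewrite scale0r add0r.
  exact: differentiable_continuous h.
have cB (B : set 'rV[R]_k) : nbhs u2 B ->
  \forall t \near (0 : R), [/\ V2 (c t), phi2 (c t) = phi1 (t *: xi + u1) & B (c t)].
  move=> uB; have [U Ou2 hO] := chart_open ch2 V2u2 uB.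
  have nO : \forall t \near (0 : R), U (phi1 (t *: xi + u1)).
    have h : {for u1, continuous phi1} by exact: differentiable_continuous.
    by apply: (cvg_comp _ _ line0 h); rewrite q12.
  have nV : \forall t \near (0 : R), V1 (t *: xi + u1).
    by apply: line0; apply: open_nbhs_nbhs.
  apply: filterS2 nO nV => t Ot Vt.
  have [w [Vw Bw] e] := hO _ Ot (M1 _ (imageP _ Vt)).
  by rewrite (cE t w Vw e); split.
have [L [cL LK]] := linear_left_inverse (inj2 _ V2u2).
have [K K0 hK] := linear_lipschitz cL.
pose X := 'd phi1 u1 xi; pose eta := L X.
have dc : is_derive (0 : R) (1 : R) c eta.
  apply: is_derive_eps => eps eps0.
  (* The remainders of phi2 and phi1, mapped by L, will be at most m' |c t - u2| and
     m |t|. As m <= 1 and m' <= 1 / 2, this gives |c t - u2| <= 2 (|eta| + 1) |t|,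
     and then both are at most eps / 2 |t|. *)
  pose m := Num.min (eps / 2) 1; have m0 : 0 < m by rewrite lt_min ltr01 divr_gt0.
  pose e2 := m / (K * (`|xi| + 1)).
  have xi1 : 0 < `|xi| + 1 by rewrite ltr_wpDl.
  have e20 : 0 < e2 by rewrite divr_gt0 // mulr_gt0.
  have eta1 : 0 < 2 * (`|eta| + 1) by rewrite mulr_gt0 // ltr_wpDl.
  pose m' := Num.min (eps / 2 / (2 * (`|eta| + 1))) (1 / 2).
  have m'0 : 0 < m' by rewrite lt_min !divr_gt0.
  pose e1 := m' / K; have e10 : 0 < e1 by rewrite divr_gt0.
  have n1 : \forall w \near u2, `|phi2 w - phi2 u2 - 'd phi2 u2 (w - u2)| <= e1 * `|w - u2|.
    rewrite (near_shift 0) /=.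
    by apply: filterS (differentiable_near_bound d2 e10) => y /=; rewrite subr0 addrK.
  have n2 : \forall t \near (0 : R), `|phi1 (t *: xi + u1) - phi1 u1 - t *: X| <= e2 * `|t *: xi|.
    have n2' := differentiable_near_bound d1 e20.
    have l0 : (fun t : R => t *: xi) @ 0 --> (0 : 'rV[R]_k).
      by rewrite -[X in _ --> X](scale0r xi); exact: scalel_continuous.
    have n2'' : \forall t \near (0 : R),
       `|phi1 (t *: xi + u1) - phi1 u1 - 'd phi1 u1 (t *: xi)| <= e2 * `|t *: xi|.
      exact: (l0 _ n2').
    by apply: filterS n2'' => t; rewrite linearZ.
  apply: filterS2 n2 (cB _ n1) => t h2 [Vt et h1].
  rewrite c0; rewrite et q12 in h1 h2; set y := c t - u2 in h1 *.
  have h3 : `|y - t *: eta| <= K * (e1 * `|y| + e2 * `|t *: xi|).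
    have -> : y - t *: eta = L ((phi1 (t *: xi + u1) - phi2 u2 - t *: X) -
         (phi1 (t *: xi + u1) - phi2 u2 - 'd phi2 u2 y)).
      by rewrite opprB [X in L X]addrC subrKA [RHS]linearB /= LK [L (t *: X)]linearZ.
    apply: le_trans (hK _) _; rewrite ler_pM2l // [leRHS]addrC.
    by apply: le_trans (ler_normB _ _) _; apply: lerD.
  have h4 : `|y - t *: eta| <= m' * `|y| + m * `|t|.
    apply: le_trans h3 _; rewrite mulrDr; apply: lerD.
      by rewrite /e1 mulrA [K * _]mulrC divfK ?gt_eqF.
    rewrite /e2 normrZ mulrA.
    have -> : K * (m / (K * (`|xi| + 1))) = m / (`|xi| + 1) by field; rewrite !gt_eqF.
    rewrite mulrAC ler_pdivrMr // -!mulrA ler_pM2l //.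
    by rewrite ler_wpM2l // lerDl.
  have h5 : `|y| <= 2 * (`|eta| + 1) * `|t|.
    have : `|y| <= `|y - t *: eta| + `|t *: eta| by rewrite -{1}(subrK (t *: eta) y) ler_normD.
    have m1 : m <= 1 by rewrite /m ge_min lexx orbT.
    have m'1 : m' <= 1 / 2 by rewrite /m' ge_min lexx orbT.
    rewrite normrZ; have := normr_ge0 t; have := normr_ge0 y; nra.
  apply: le_trans h4 _.
  have m2 : m <= eps / 2 by rewrite /m ge_min lexx.
  have m'2 : m' * (2 * (`|eta| + 1)) <= eps / 2.
    by rewrite -ler_pdivlMr // /m' ge_min lexx.
  have : m' * `|y| <= eps / 2 * `|t|.
    apply: (@le_trans _ _ (m' * (2 * (`|eta| + 1) * `|t|))); first by rewrite ler_pM2l.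
    by rewrite mulrA ler_wpM2r.
  have := normr_ge0 t; nra.
exists c, eta; split => //.
  by apply: filterS (cB setT filterT) => t [].
have dphi2 : differentiable phi2 (c 0) by rewrite c0.
have h1 := is_derive_chain dphi2 dc.
have d1' : differentiable phi1 (0 *: xi + u1) by rewrite scale0r add0r.
have h2 := is_derive_chain (c := fun t : R => t *: xi + u1) d1' (is_derive_affine xi u1 0).
have e : \forall t \near (0 : R), phi2 (c t) = phi1 (t *: xi + u1).
  by apply: filterS (cB setT filterT) => t [].
have [_ h3] := near_eq_is_derive e h1; have [_ h4] := h2.
by rewrite h3 c0 scale0r add0r in h4.
Qed.

End Transition.

(** * Submanifolds of a flat metric space *)

(** The coordinates iota and the coefficients c present the metric as a weighted dot
    product; the Euclidean and the neutral metric are both of this form. *)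
Section Metric.
Variables (R : realType) (E : normedModType R) (N : nat) (iota : {linear E -> 'rV[R]_N}).
Variables (c : 'I_N -> R) (g : E -> E -> R).
Hypothesis iota_cont : continuous iota.
Hypothesis iota_inj : injective iota.
Hypothesis gE : forall x y, g x y = \sum_(j < N) c j * (iota x 0 j * iota y 0 j).
Variables (k : nat) (M : set E).

Lemma metricC x y : g x y = g y x.
Proof. by rewrite !gE; apply: eq_bigr => j _; rewrite [iota x 0 j * _]mulrC. Qed.

Lemma metricDl x y z : g (x + y) z = g x z + g y z.
Proof. by rewrite !gE -big_split /=; apply: eq_bigr => j _; rewrite linearD mxE mulrDl mulrDr. Qed.

Lemma metricZl a x z : g (a *: x) z = a * g x z.
Proof. rewrite !gE mulr_sumr; apply: eq_bigr => j _; rewrite linearZ mxE; ring. Qed.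

Lemma metricNl x z : g (- x) z = - g x z.
Proof. by rewrite -scaleN1r metricZl mulN1r. Qed.

Lemma metricBl x y z : g (x - y) z = g x z - g y z.
Proof. by rewrite metricDl metricNl. Qed.

Lemma metric0l z : g 0 z = 0.
Proof. by rewrite -(scale0r 0) metricZl mul0r. Qed.

Lemma metric_suml (I : Type) (r : seq I) (F : I -> E) z :
  g (\sum_(i <- r) F i) z = \sum_(i <- r) g (F i) z.
Proof. by apply: (big_morph (g^~ z)) => [x y|]; rewrite ?metricDl ?metric0l. Qed.

Lemma is_derive_metric (V : normedModType R) (f h : V -> E) x v df dh :
  is_derive x v f df -> is_derive x v h dh ->
  is_derive x v (fun t => g (f t) (h t)) (g df (h x) + g (f x) dh).
Proof.
move=> hf hh; under eq_fun do rewrite gE; rewrite !gE -big_split /=.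
apply: is_derive_sum_seq => j.
have fj := is_derive_coord j (is_derive_lin iota_cont hf).
have hj := is_derive_coord j (is_derive_lin iota_cont hh).
have := is_deriveZ (c j) (is_deriveM fj hj).
move=> D; apply: (is_derive_eq D) => /=.
by rewrite /GRing.scale /=; ring.
Qed.

Lemma tangent_spaceP V phi (u : 'rV[R]_k) X : chart M V phi -> V u ->
  tangent_space k M (phi u) X <-> exists xi, X = 'd phi u xi.
Proof.
move=> ch Vu; split=> [[V1 [phi1 [u1 [xi [ch1 V1u1 e ->]]]]]|[xi ->]]; last first.
  by exists V, phi, u, xi.
have [_ [eta [_ _ _ e2]]] := chart_transition iota_cont iota_inj xi ch1 ch V1u1 Vu e.
by exists eta; exact: esym e2.
Qed.

Lemma chart_differentiable V (phi : 'rV[R]_k -> E) u : chart M V phi -> V u -> differentiable phi u.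
Proof. by move=> [_ s _ _ _] Vu; have [h _] := s 1%N; apply: h. Qed.

Lemma tangent_lin V phi (u : 'rV[R]_k) a X Y : chart M V phi -> V u ->
  tangent_space k M (phi u) X -> tangent_space k M (phi u) Y ->
  tangent_space k M (phi u) (a *: X + Y).
Proof.
move=> ch Vu /(tangent_spaceP _ ch Vu)[x ->] /(tangent_spaceP _ ch Vu)[y ->].
by apply/(tangent_spaceP _ ch Vu); exists (a *: x + y); rewrite linearP.
Qed.

(** No vector of an orthonormal family is isotropic, so its k members are independent
    and form a basis of the tangent space. *)
Lemma frame_coords V phi (u : 'rV[R]_k) (e : 'I_k -> E) : chart M V phi -> V u ->
  orthonormal_frame g M (phi u) e ->
  exists2 Xi : 'M[R]_k, Xi \in unitmx & forall i, e i = 'd phi u (row i Xi).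
Proof.
move=> ch Vu [te ne oe].
have /choice[xi hxi] : forall i, exists xi, e i = 'd phi u xi.
  by move=> i; apply/(tangent_spaceP _ ch Vu).
exists (\matrix_i xi i) => [|i]; last by rewrite rowK.
rewrite -row_free_unit -kermx_eq0; apply/eqP/row_matrixP => i; rewrite row0.
set a := row i _; have : a *m (\matrix_i xi i) = 0 by apply: sub_kermxP; rewrite row_sub.
move=> /(congr1 ('d phi u)); rewrite linear0 mulmx_sum_row linear_sum => s0.
apply/rowP => j; rewrite [RHS]mxE.
have : g (\sum_i a 0 i *: e i) (e j) = a 0 j * g (e j) (e j).
  rewrite metric_suml (bigD1 j) //= metricZl big1 ?addr0 // => l lj.
  by rewrite metricZl oe ?mulr0.
have -> : \sum_i a 0 i *: e i = 0.
  by rewrite -[RHS]s0; apply: eq_bigr => l _; rewrite linearZ /= rowK hxi.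
rewrite metric0l => /esym/eqP; rewrite mulf_eq0 => /orP[/eqP //|].
by case: (ne j) => ->; rewrite ?oppr_eq0 oner_eq0.
Qed.

Lemma frame_expansion V phi (u : 'rV[R]_k) (e : 'I_k -> E) X : chart M V phi -> V u ->
  orthonormal_frame g M (phi u) e -> tangent_space k M (phi u) X ->
  X = \sum_i (g (e i) (e i) * g X (e i)) *: e i.
Proof.
move=> ch Vu fr /(tangent_spaceP _ ch Vu)[x ->].
have [Xi uXi eXi] := frame_coords ch Vu fr; have [te ne oe] := fr.
have xE : 'd phi u x = \sum_i (x *m invmx Xi) 0 i *: e i.
  rewrite -{1}(mulmxKV uXi x) mulmx_sum_row linear_sum; apply: eq_bigr => i _.
  by rewrite linearZ eXi.
rewrite {1}xE; apply: eq_bigr => i _; congr (_ *: _).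
rewrite xE metric_suml (bigD1 i) //= metricZl big1 ?addr0 => [|l li]; last first.
  by rewrite metricZl oe ?mulr0.
by case: (ne i) => ->; ring.
Qed.

(** Orthogonal projection by means of the frame. *)
Lemma tangent_normal_decomposition V phi (u : 'rV[R]_k) (e : 'I_k -> E) W : chart M V phi -> V u ->
  orthonormal_frame g M (phi u) e ->
  exists z, normal_space g k M (phi u) z /\ tangent_space k M (phi u) (W - z).
Proof.
move=> ch Vu fr; have [te ne oe] := fr.
exists (W - \sum_i (g (e i) (e i) * g W (e i)) *: e i); split; last first.
  rewrite opprB addrCA subrr addr0.
  elim: (index_enum _) => [|i r IH].
    by rewrite big_nil; apply/(tangent_spaceP _ ch Vu); exists 0; rewrite linear0.
  by rewrite big_cons; exact: (tangent_lin _ ch Vu (te i) IH).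
move=> X /(frame_expansion ch Vu fr) ->.
rewrite metricC metric_suml big1 // => i _; rewrite metricZl [g (e i) (W - _)]metricC metricBl.
rewrite metric_suml (bigD1 i) //= big1 => [|l li]; last by rewrite metricZl (oe l i) ?mulr0.
rewrite metricZl addr0 mulrAC.
by case: (ne i) => ->; ring.
Qed.

(** Differentiating g (Y, nu) = 0 along a curve gives g (D_X Y, nu) = - g (Y, D_X
    nu). The field Y admitted by the definition may be given in any chart; the curve
    of [chart_transition] carries it to the chart of nu. So one normal field in one
    chart computes the second fundamental form. *)
Lemma second_ff_normal_field V phi (nu : 'rV[R]_k -> E) u xi Y0 (e : 'I_k -> E) :
  chart M V phi -> V u -> orthonormal_frame g M (phi u) e ->
  tangent_space k M (phi u) Y0 ->
  (forall w, V w -> differentiable nu w /\ normal_space g k M (phi w) (nu w)) ->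
  normal_space g k M (phi u) (second_ff g k M (phi u) ('d phi u xi) Y0) /\
  g (second_ff g k M (phi u) ('d phi u xi) Y0) (nu u) = - g Y0 ('D_xi nu u).
Proof.
move=> ch Vu fr tY hnu.
rewrite /second_ff; set S := [set z | _].
(* The definition is not vacuous: take Y with constant coefficients in the chart phi
   and project its derivative. *)
have : S (get S).
  apply: getPex; have [eta Y0E] := (tangent_spaceP Y0 ch Vu).1 tY.
  have [oV s _ _ _] := ch.
  pose Y w := 'D_eta phi w.
  have [z [nz tz]] := tangent_normal_decomposition ('D_xi Y u) ch Vu fr.
  exists z, V, phi, u, xi, Y; split=> //; split => //.
    split=> [m|w Vw]; first by have [_ h] := s m.+1; apply: h.
    apply/(tangent_spaceP _ ch Vw); exists eta.
    exact: (deriveE _ (chart_differentiable ch Vw)).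
  by rewrite Y0E; exact: (deriveE _ (chart_differentiable ch Vu)).
move: (get S) => z [V1 [phi1 [u1 [xi1 [Y [ch1 [V1u1 qE] XE [tfY Y0E] [nz tz]]]]]]].
split=> //.
have [cv [eta [cv0 ncv dcv etaE]]] := chart_transition iota_cont iota_inj xi1 ch1 ch V1u1 Vu qE.
have etaxi : eta = xi.
  have [_ _ inj _ _] := ch; apply: (inj _ Vu).
  exact: etrans etaE (esym XE).
rewrite {}etaxi in dcv.
have [dnu nnu] := hnu _ Vu.
have : g (nu u) ('D_xi1 Y u1 - z) = 0 by apply: nnu.
rewrite metricC metricBl => /eqP; rewrite subr_eq0 => /eqP <-.
apply/eqP; rewrite -addr_eq0; apply/eqP.
have [sY tY1] := tfY.
have dY : differentiable Y u1 by have [h _] := sY 1%N; apply: h.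
have DY : is_derive (0 : R) 1 (fun t : R => Y (t *: xi1 + u1)) ('D_xi1 Y u1).
  have dYx : derivable Y u1 xi1 by apply: diff_derivable; exact: dY.
  exact: (is_derive_line Y u1 xi1 _).1 (derivableP dYx).
have Dnu : is_derive (0 : R) 1 (fun t : R => nu (cv t)) ('D_xi nu u).
  rewrite (deriveE _ dnu); rewrite -cv0 in dnu *.
  exact: (is_derive_chain dnu dcv).
have := is_derive_metric DY Dnu; rewrite scale0r add0r cv0 Y0E => -[_ <-].
have [oV1 _ _ _ _] := ch1.
have n0 : \forall t \near (0 : R), g (Y (t *: xi1 + u1)) (nu (cv t)) = cst 0 t.
  have nV1 : \forall t \near (0 : R), V1 (t *: xi1 + u1).
    have [/derivable1_diffP h _] := is_derive_affine xi1 u1 0.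
    apply: (differentiable_continuous h); rewrite scale0r add0r.
    exact: open_nbhs_nbhs.
  apply: filterS2 ncv nV1 => t [Vt et] V1t.
  rewrite metricC; apply: (hnu _ Vt).2; rewrite et; exact: tY1.
by rewrite (near_eq_derive _ n0) derive_cst.
Qed.

Lemma Schwarz V (f : 'rV[R]_k -> E) (u v w : 'rV[R]_k) :
  open V -> V u -> Ck 2 V f ->
  'D_v (fun y => 'D_w f y) u = 'D_w (fun y => 'D_v f y) u.
Proof.
move=> oV Vu cf; apply: iota_inj; apply/rowP => j.
have cfj : Ck 2 V (fun y => iota (f y) 0 j).
  exact: (@Ck_coord _ _ _ 2 V (iota \o f) j oV (Ck_lin oV iota_cont cf)).
have e (a b : 'rV[R]_k) : iota ('D_a (fun y => 'D_b f y) u) 0 j =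
   'D_a (fun y => 'D_b (fun y => iota (f y) 0 j) y) u.
  have [df /(_ b) [dDf _]] := cf.
  have /derivableP h : derivable (fun y => 'D_b f y) u a by exact/diff_derivable/dDf.
  have [_ <-] := is_derive_coord j (is_derive_lin iota_cont h).
  apply: near_eq_derive; apply: open_near oV Vu _ => y Vy.
  have /derivableP hy : derivable f y b by exact/diff_derivable/df.
  by have [_ <-] := is_derive_coord j (is_derive_lin iota_cont hy).
have S := Schwarz_scalar v w oV Vu cfj.
have e1 := e v w.
have e2 := e w v.
refine (etrans e1 _).
refine (etrans S _).
exact: esym e2.
Qed.

Lemma metric_gram (L : {linear 'rV[R]_k -> E}) x y :
  g (L x) (L y) =
  (x *m (\matrix_(i, j) g (L (delta_mx 0 i)) (L (delta_mx 0 j))) *m y^T) 0 0.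
Proof.
rewrite -mulmxA mxE {1}(row_sum_delta x) linear_sum metric_suml.
apply: eq_bigr => i _; rewrite linearZ metricZl mxE; congr (_ * _).
rewrite {1}(row_sum_delta y) linear_sum metricC metric_suml.
by apply: eq_bigr => j _; rewrite linearZ metricZl !mxE mulrC metricC.
Qed.

Lemma frame_exists V phi (u : 'rV[R]_k) : chart M V phi -> V u ->
  \matrix_(i, j) g ('d phi u (delta_mx 0 i)) ('d phi u (delta_mx 0 j)) \in unitmx ->
  exists e : 'I_k -> E, orthonormal_frame g M (phi u) e.
Proof.
move=> ch Vu uG; set G := \matrix_(i, j) _ in uG.
have sG : G^T = G by apply/matrixP => i j; rewrite !mxE metricC.
have [F [eps [heps FG]]] := sym_congruence sG uG.
have gF i j : g ('d phi u (row i F)) ('d phi u (row j F)) = if i == j then eps i else 0.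
  have h := metric_gram ('d phi u) (row i F) (row j F).
  rewrite h -/G -row_mul tr_row colE mulmxA -colE -row_mul FG !mxE.
  by case: eqVneq => // ->.
exists (fun i => 'd phi u (row i F)); split.
- by move=> i; apply/(tangent_spaceP _ ch Vu); exists (row i F).
- by move=> i; rewrite gF eqxx.
- by move=> i j ij; rewrite gF (negPf ij).
Qed.

Lemma frame_nondegenerate V phi (u : 'rV[R]_k) (e : 'I_k -> E) : chart M V phi -> V u ->
  orthonormal_frame g M (phi u) e -> nondegenerate g k M (phi u).
Proof.
move=> ch Vu fr X tX h; rewrite (frame_expansion ch Vu fr tX) big1 // => i _.
by have [te _ _] := fr; rewrite h ?mulr0 ?scale0r.
Qed.

End Metric.

(** * The para-complex space in null coordinates *)

Section FlatSpaces.
Variables (R : realType) (n : nat).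

Definition euclidean_coords : {linear 'rV[R]_n -> 'rV[R]_n} :=
  [the {linear 'rV[R]_n -> 'rV[R]_n} of idfun].

Lemma euclidean_coords_continuous : continuous euclidean_coords.
Proof. by move=> x; exact: cvg_id. Qed.

Lemma euclidean_coords_inj : injective euclidean_coords.
Proof. by []. Qed.

Lemma euclideanE (x y : 'rV[R]_n) : euclidean x y =
  \sum_(j < n) (fun=> 1) j * (euclidean_coords x 0 j * euclidean_coords y 0 j).
Proof. by apply: eq_bigr => j _; rewrite mul1r. Qed.

Lemma dot_mx (x y : 'rV[R]_n) : euclidean x y = (x *m y^T) 0 0.
Proof. by rewrite mxE; apply: eq_bigr => j _; rewrite mxE. Qed.

Definition pair_row (z : paraD R n) : 'rV[R]_(n + n) := row_mx z.1 z.2.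

Lemma pair_row_is_linear : linear pair_row.
Proof. by move=> a x y; rewrite /pair_row scale_row_mx add_row_mx. Qed.

HB.instance Definition _ :=
  GRing.isLinear.Build R (paraD R n) 'rV[R]_(n + n) _ pair_row pair_row_is_linear.

Lemma pair_row_inj : injective pair_row.
Proof. by move=> [a b] [c d] /eq_row_mx[/= -> ->]. Qed.

Lemma pair_row_continuous : continuous pair_row.
Proof. exact: row_mx_continuous. Qed.

Definition neutral_sign (j : 'I_(n + n)) : R := if (j < n)%N then 1 else -1.

Definition neutral_coords : {linear paraD R n -> 'rV[R]_(n + n)} :=
  [the {linear paraD R n -> 'rV[R]_(n + n)} of pair_row].

Lemma neutral_coords_continuous : continuous neutral_coords.
Proof. exact: pair_row_continuous. Qed.

Lemma neutral_coords_inj : injective neutral_coords.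
Proof. exact: pair_row_inj. Qed.

Lemma neutralE (z w : paraD R n) : neutral z w =
  \sum_(j < n + n) neutral_sign j * (neutral_coords z 0 j * neutral_coords w 0 j).
Proof.
rewrite big_split_ord /= /neutral sumrB -sumrN; congr (_ + _).
  by apply: eq_bigr => j _; rewrite /neutral_sign /= ltn_ord mul1r !row_mxEl.
by apply: eq_bigr => j _; rewrite /neutral_sign /= ltnNge leq_addr mulN1r !row_mxEr.
Qed.

Lemma neutral_dot (z w : paraD R n) :
  neutral z w = (z.1 *m w.1^T) 0 0 - (z.2 *m w.2^T) 0 0.
Proof. by rewrite /neutral sumrB -!dot_mx. Qed.

Definition para_J (z : paraD R n) : paraD R n := (z.2, z.1).

Lemma para_J_is_linear : linear para_J.
Proof. by move=> a x y. Qed.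

HB.instance Definition _ :=
  GRing.isLinear.Build R (paraD R n) (paraD R n) _ para_J para_J_is_linear.

Lemma para_J_continuous : continuous para_J.
Proof.
move=> z.
have h1 : {for z, continuous (@snd 'rV[R]_n 'rV[R]_n)} by exact: cvg_snd.
have h2 : {for z, continuous (@fst 'rV[R]_n 'rV[R]_n)} by exact: cvg_fst.
exact: cvg_pair h1 h2.
Qed.

(** Null coordinates: [para_J] acts on them by 1 and by -1, and the metric pairs the
    first one with the second. *)
Definition null_plus (z : paraD R n) : 'rV[R]_n := z.1 + z.2.
Definition null_minus (z : paraD R n) : 'rV[R]_n := z.1 - z.2.

Lemma null_plus_is_linear : linear null_plus.
Proof. by move=> a x y; rewrite /null_plus /= scalerDr addrACA. Qed.

Lemma null_minus_is_linear : linear null_minus.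
Proof. by move=> a x y; rewrite /null_minus /= scalerBr opprD addrACA. Qed.

HB.instance Definition _ :=
  GRing.isLinear.Build R (paraD R n) 'rV[R]_n _ null_plus null_plus_is_linear.
HB.instance Definition _ :=
  GRing.isLinear.Build R (paraD R n) 'rV[R]_n _ null_minus null_minus_is_linear.

Lemma null_plus_continuous : continuous null_plus.
Proof. by move=> z; apply: continuousD; [exact: cvg_fst | exact: cvg_snd]. Qed.

Lemma null_minus_continuous : continuous null_minus.
Proof. by move=> z; apply: continuousB; [exact: cvg_fst | exact: cvg_snd]. Qed.

Lemma neutral_null (z w : paraD R n) :
  2 * neutral z w = (null_plus z *m (null_minus w)^T) 0 0 + (null_minus z *m (null_plus w)^T) 0 0.
Proof.
rewrite neutral_dot -!dot_mx /euclidean -sumrB mulr_sumr -big_split /=.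
by apply: eq_bigr => j _; rewrite !mxE; ring.
Qed.

Lemma neutral_null_J (z w : paraD R n) :
  2 * neutral z (para_J w) =
  (null_minus z *m (null_plus w)^T) 0 0 - (null_plus z *m (null_minus w)^T) 0 0.
Proof.
rewrite neutral_dot -!dot_mx /euclidean -sumrB mulr_sumr -sumrB /=.
by apply: eq_bigr => j _; rewrite !mxE; ring.
Qed.

Lemma null_inj (z : paraD R n) : null_plus z = 0 -> null_minus z = 0 -> z = 0.
Proof.
move=> hp hm.
have e1 : z.1 = 2^-1 *: (null_plus z + null_minus z).
  by apply/rowP => j; rewrite !mxE; field.
have e2 : z.2 = 2^-1 *: (null_plus z - null_minus z).
  by apply/rowP => j; rewrite !mxE; field.
by apply: injective_projections; rewrite ?e1 ?e2 hp hm ?subr0 ?addr0 scaler0.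
Qed.

End FlatSpaces.

(** * Mean curvature of Lagrangian submanifolds *)

Section Lagrangian.
Variables (R : realType) (n : nat).
Local Notation E := (paraD R n).
Let gE := @neutralE R n.
Let io_cont := @neutral_coords_continuous R n.
Let io_inj := @neutral_coords_inj R n.
Variables (M : set E) (V : set 'rV[R]_n) (Phi : 'rV[R]_n -> E).
Hypothesis ch : chart M V Phi.
Hypothesis lag : forall w x y, V w ->
  neutral ('d Phi w x) (para_J ('d Phi w y)) = 0.

Definition tangent_mx (L : {linear E -> 'rV[R]_n}) w : 'M[R]_n :=
  \matrix_(i < n) L ('D_(delta_mx 0 i) Phi w).

Definition tangent_mx_deriv (L : {linear E -> 'rV[R]_n}) eta w : 'M[R]_n :=
  \matrix_(i < n) L ('D_eta (fun y => 'D_(delta_mx 0 i) Phi y) w).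

Let dPhi w : V w -> differentiable Phi w := fun Vw => chart_differentiable ch Vw.

Let dDPhi eta w : V w -> differentiable (fun y => 'D_eta Phi y) w.
Proof. by move=> Vw; have [_ s _ _ _] := ch; have [_ /(_ eta) [h _]] := s 2%N; apply: h. Qed.

Lemma tangent_mxP (L : {linear E -> 'rV[R]_n}) w x : V w ->
  L ('d Phi w x) = x *m tangent_mx L w.
Proof.
move=> Vw; have := linear_rV_mulmx [the {linear 'rV[R]_n -> 'rV[R]_n} of L \o 'd Phi w] x.
move=> /= ->; congr (_ *m _); apply/row_matrixP => i; rewrite !rowK.
by rewrite (deriveE _ (dPhi Vw)).
Qed.

(** Schwarz's theorem enters here: the derivative along x of the field given by eta
    is expressed by derivatives along eta. *)
Lemma tangent_mx_derivP (L : {linear E -> 'rV[R]_n}) eta w x : V w ->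
  L ('D_x (fun y => 'D_eta Phi y) w) = x *m tangent_mx_deriv L eta w.
Proof.
move=> Vw; rewrite (deriveE _ (dDPhi eta Vw)).
have := linear_rV_mulmx [the {linear 'rV[R]_n -> 'rV[R]_n} of L \o 'd (fun y => 'D_eta Phi y) w] x.
move=> /= ->; congr (_ *m _); apply/row_matrixP => i; rewrite !rowK; congr (L _).
have [oV s _ _ _] := ch.
have e := Schwarz io_cont io_inj (delta_mx 0 i) eta oV Vw (s 2%N).
exact: etrans (esym (deriveE _ (dDPhi eta Vw))) e.
Qed.

Lemma is_derive_tangent_mx (L : {linear E -> 'rV[R]_n}) eta w i j : continuous L -> V w ->
  is_derive w eta (fun y => tangent_mx L y i j) (tangent_mx_deriv L eta w i j).
Proof.
move=> cL Vw.
have h : derivable (fun y => 'D_(delta_mx 0 i) Phi y) w eta.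
  by apply: diff_derivable; exact: dDPhi.
have D := is_derive_coord j (is_derive_lin cL (derivableP h)).
have e1 : (fun y => tangent_mx L y i j) = (fun y => L ('D_(delta_mx 0 i) Phi y) 0 j).
  by apply: eq_fun => y; rewrite mxE.
have e2 : tangent_mx_deriv L eta w i j = L ('D_eta (fun y => 'D_(delta_mx 0 i) Phi y) w) 0 j.
  by rewrite mxE.
by rewrite e1 e2; exact: D.
Qed.

Opaque tangent_mx tangent_mx_deriv.
Local Notation P := (tangent_mx [the {linear E -> 'rV[R]_n} of @null_plus R n]).
Local Notation Q := (tangent_mx [the {linear E -> 'rV[R]_n} of @null_minus R n]).
Local Notation P' := (tangent_mx_deriv [the {linear E -> 'rV[R]_n} of @null_plus R n]).
Local Notation Q' := (tangent_mx_deriv [the {linear E -> 'rV[R]_n} of @null_minus R n]).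

(** On a Lagrangian tangent space the two null pairings agree, so the Gram matrix of
    the metric factors. *)
Lemma neutral_tangent_mx w x y : V w ->
  neutral ('d Phi w x) ('d Phi w y) = (x *m (P w *m (Q w)^T) *m y^T) 0 0.
Proof.
move=> Vw; have h := lag x y Vw.
have := neutral_null_J ('d Phi w x) ('d Phi w y); rewrite h mulr0 => /esym/eqP.
rewrite subr_eq0 => /eqP h2.
have := neutral_null ('d Phi w x) ('d Phi w y); rewrite h2 -mulr2n -[RHS]mulr_natl.
move=> /mulfI -> //; rewrite !tangent_mxP // trmx_mul !mulmxA //.
Qed.

Variables (u : 'rV[R]_n) (e : 'I_n -> E).
Hypothesis Vu : V u.
Hypothesis fr : orthonormal_frame (@neutral R n) M (Phi u) e.

Lemma tangent_mx_frame : exists2 Xi : 'M[R]_n,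
  Xi \in unitmx & (forall i, e i = 'd Phi u (row i Xi)) /\
  (Xi *m P u) *m (Xi *m Q u)^T = diag_mx (\row_i neutral (e i) (e i)).
Proof.
have [Xi uXi eXi] := frame_coords io_cont io_inj gE ch Vu fr.
exists Xi => //; split => //.
apply/matrixP => i j; have [_ _ oe] := fr.
have <- : neutral (e i) (e j) = ((Xi *m P u) *m (Xi *m Q u)^T) i j.
  rewrite !eXi neutral_tangent_mx // -row_mul tr_row colE mulmxA -colE -row_mul.
  by rewrite trmx_mul !mulmxA !mxE.
rewrite !mxE; case: eqVneq => [->|ij]; first by [].
exact: oe.
Qed.

Lemma tangent_mx_unit : P u \in unitmx /\ Q u \in unitmx.
Proof.
have [Xi uXi [eXi PQ]] := tangent_mx_frame; have [_ ne _] := fr.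
have : (Xi *m P u) *m (Xi *m Q u)^T \in unitmx.
  rewrite PQ unitmxE det_diag unitfE; apply/prodf_neq0 => i _; rewrite mxE.
  by case: (ne i) => ->; rewrite ?oppr_eq0 oner_neq0.
rewrite trmx_mul !unitmx_mul unitmx_tr => /andP[/andP[_ ->] /andP[-> _]] //.
Qed.

(** The tangent vectors and their images under [para_J] span the ambient space, since
    P and Q are invertible. *)
Lemma normal_eq0 (H : E) : normal_space (@neutral R n) n M (Phi u) H ->
  (forall eta, neutral H (para_J ('d Phi u eta)) = 0) -> H = 0.
Proof.
move=> nH hJ; have [uP uQ] := tangent_mx_unit.
have h0 (eta : 'rV[R]_n) : null_minus H *m (P u)^T *m eta^T = 0 /\
    null_plus H *m (Q u)^T *m eta^T = 0.
  have h1 : neutral H ('d Phi u eta) = 0.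
    by apply: nH; apply/(tangent_spaceP io_cont io_inj _ ch Vu); exists eta.
  have := neutral_null_J H ('d Phi u eta); have := neutral_null H ('d Phi u eta).
  rewrite h1 hJ !tangent_mxP // !trmx_mul !mulmxA mulr0.
  set a := (null_plus H *m _ *m _); set b := (null_minus H *m _ *m _) => h2 h3.
  have b0 : b 0 0 = 0 by lra.
  have a0 : a 0 0 = 0 by lra.
  by split; apply/matrixP => i j; rewrite !ord1 [RHS]mxE.
have row0 (v : 'rV[R]_n) : (forall eta : 'rV[R]_n, v *m eta^T = 0) -> v = 0.
  move=> h; apply/rowP => j; have := h (delta_mx 0 j).
  by rewrite trmx_delta -colE => /matrixP /(_ 0 0); rewrite !mxE.
apply: null_inj.
  have : null_plus H *m (Q u)^T = 0 by apply: row0 => eta; exact: (h0 eta).2.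
  by move=> /(congr1 (mulmx^~ (invmx (Q u)^T))); rewrite mulmxK ?unitmx_tr // mul0mx.
have : null_minus H *m (P u)^T = 0 by apply: row0 => eta; exact: (h0 eta).1.
by move=> /(congr1 (mulmx^~ (invmx (P u)^T))); rewrite mulmxK ?unitmx_tr // mul0mx.
Qed.

(** Let H be the sum of the eps_i h(e_i, e_i). As [para_J] maps the fields given by
    eta to normal fields, twice the product of H with the image of such a field is
    the logarithmic derivative of det Q minus that of det P along eta, and these
    products determine H. *)
Lemma mean_curvature_lagrangian :
  mean_curvature (@neutral R n) M (Phi u) e = 0 <->
  forall eta, \det (Q u) * \tr (P' eta u *m \adj (P u)) =
              \det (P u) * \tr (Q' eta u *m \adj (Q u)).
Proof.
have [Xi uXi [eXi PQ]] := tangent_mx_frame; have [te ne oe] := fr.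
have [uP uQ] := tangent_mx_unit.
pose II i := second_ff (@neutral R n) n M (Phi u) (e i) (e i).
pose H : E := \sum_(i < n) neutral (e i) (e i) *: II i.
have nu_eta eta w : V w -> differentiable (fun y => para_J ('D_eta Phi y)) w /\
    normal_space (@neutral R n) n M (Phi w) (para_J ('D_eta Phi w)).
  move=> Vw; split.
    have dJ : differentiable (@para_J R n) ('D_eta Phi w).
      exact/linear_differentiable/para_J_continuous.
    exact: (differentiable_comp (dDPhi eta Vw) dJ).
  move=> X /(tangent_spaceP io_cont io_inj _ ch Vw)[x ->].
  rewrite (metricC gE) (deriveE _ (dPhi Vw)); exact: lag.
have IIP i eta : normal_space (@neutral R n) n M (Phi u) (II i) /\
   2 * neutral (II i) (para_J ('d Phi u eta)) =
     ((Xi *m P u) *m (Xi *m Q' eta u)^T) i i - ((Xi *m Q u) *m (Xi *m P' eta u)^T) i i.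
  have := second_ff_normal_field io_cont io_inj gE (row i Xi) ch Vu fr (te i) (nu_eta eta).
  rewrite -eXi => -[nII h]; split => //.
  rewrite -(deriveE _ (dPhi Vu)) h.
  have dd : derivable (fun y => 'D_eta Phi y) u (row i Xi).
    by apply: diff_derivable; exact: dDPhi.
  have [_ dJ] := is_derive_lin (@para_J_continuous R n) (derivableP dd).
  rewrite [X in neutral _ X]dJ mulrN neutral_null_J opprB eXi !tangent_mxP // !tangent_mx_derivP //.
  have rc (A B : 'M[R]_n) :
      ((Xi *m A) *m (Xi *m B)^T) i i = ((row i Xi *m A) *m (row i Xi *m B)^T) 0 0.
    rewrite [LHS]mxE [RHS]mxE; apply: eq_bigr => k _.
    rewrite [_^T k i]mxE [_^T k 0]mxE; congr (_ * _).
      by rewrite [LHS]mxE [RHS]mxE; apply: eq_bigr => l _; rewrite [row i Xi 0 l]mxE.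
    by rewrite [LHS]mxE [RHS]mxE; apply: eq_bigr => l _; rewrite [row i Xi 0 l]mxE.
  move: (P u) (Q u) (P' eta u) (Q' eta u) => A B C D.
  by rewrite (rc A D) (rc B C).
have nH : normal_space (@neutral R n) n M (Phi u) H.
  move=> X tX; rewrite (metric_suml gE) big1 // => i _.
  by rewrite (metricZl gE) (IIP i 0).1 ?mulr0.
have epsE i : (\row_i neutral (e i) (e i)) 0 i * (\row_i neutral (e i) (e i)) 0 i = 1.
  by rewrite mxE; case: (ne i) => ->; rewrite ?mulrNN mulr1.
have QP : (Xi *m Q u) *m (Xi *m P u)^T = diag_mx (\row_i neutral (e i) (e i)).
  by rewrite -[LHS]trmxK trmx_mul trmxK PQ tr_diag_mx.
have HJ eta : 2 * neutral H (para_J ('d Phi u eta)) =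
    \tr (Q' eta u *m \adj (Q u)) / \det (Q u) - \tr (P' eta u *m \adj (P u)) / \det (P u).
  rewrite (metric_suml gE) mulr_sumr.
  rewrite -(trace_frame_logderiv _ epsE QP) -(trace_frame_logderiv _ epsE PQ) -sumrB.
  apply: eq_bigr => i _; rewrite (metricZl gE) mulrCA (IIP i eta).2 -mulrBr.
  by rewrite [(\row_i0 _) 0 i]mxE.
have dP0 : \det (P u) != 0 by rewrite -unitfE -unitmxE.
have dQ0 : \det (Q u) != 0 by rewrite -unitfE -unitmxE.
have eqv eta : neutral H (para_J ('d Phi u eta)) = 0 <->
   \det (Q u) * \tr (P' eta u *m \adj (P u)) = \det (P u) * \tr (Q' eta u *m \adj (Q u)).
  have := HJ eta.
  move: (neutral H _) (\tr (P' eta u *m _)) (\tr _) (\det (P u)) (\det (Q u)) dP0 dQ0.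
  move=> x a b c d c0 d0 hx; split.
    move=> x0; move: hx; rewrite x0 mulr0 => /esym/eqP; rewrite subr_eq0 eqr_div // => /eqP h.
    by rewrite mulrC -h mulrC.
  move=> hh; have : 2 * x = 0.
    by apply/eqP; rewrite hx subr_eq0 eqr_div // [b * _]mulrC -hh mulrC.
  by move=> /eqP; rewrite mulf_eq0 pnatr_eq0 /= => /eqP.
have HE : mean_curvature (@neutral R n) M (Phi u) e = 0 <-> H = 0.
  rewrite /mean_curvature -/H; split=> [h0|->]; last by rewrite scaler0.
  case: (posnP n) => [n0|n0].
    by apply: injective_projections; apply/rowP => j; have := ltn_ord j;
      rewrite [X in (_ < X)%N]n0 ltn0.
  by move/eqP: h0; rewrite scaler_eq0 invr_eq0 pnatr_eq0 eqn0Ngt n0 /= => /eqP.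
split=> [/HE H0 eta|h].
  by apply/eqv; rewrite H0 (metric0l gE).
apply/HE; apply: normal_eq0 nH _ => eta; exact/eqv.
Qed.

End Lagrangian.

(** * A parametrization of the normal bundle *)

Section NormalBundleChart.
Variables (R : realType) (p m : nat).
Local Notation n := (p + m)%N.
Variables (S : set 'rV[R]_n) (V : set 'rV[R]_p) (phi : 'rV[R]_p -> 'rV[R]_n).
Hypothesis ch : chart S V phi.
Variable W : 'M[R]_(m, n).
Let eE := @euclideanE R n.
Let id_cont := @euclidean_coords_continuous R n.
Let id_inj := @euclidean_coords_inj R n.

Definition chart_jacobian u : 'M[R]_(p, n) := \matrix_(i < p) 'D_(delta_mx 0 i) phi u.
Definition completed_jacobian u : 'M[R]_n := col_mx (chart_jacobian u) W.
(** The last columns of the inverse matrix are orthogonal to the tangent rows and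
    dual to the rows of W. As W is constant, the coordinates y W^T of a normal vector
    y do not involve the base point. *)
Definition normal_frame u : 'M[R]_(m, n) := (rsubmx (invmx (completed_jacobian u)))^T.
Definition frame_domain : set 'rV[R]_p := [set u | V u /\ completed_jacobian u \in unitmx].

Lemma chart_jacobianP u x : V u -> 'd phi u x = x *m chart_jacobian u.
Proof.
move=> Vu; rewrite linear_rV_mulmx; congr (_ *m _); apply/row_matrixP => i.
rewrite !rowK; exact: esym (deriveE _ (chart_differentiable ch Vu)).
Qed.

Lemma chart_jacobian_free u : V u -> row_free (chart_jacobian u).
Proof.
move=> Vu; rewrite -kermx_eq0; apply/eqP/row_matrixP => i; rewrite row0.
have [_ _ inj _ _] := ch; apply: (inj _ Vu).
by rewrite linear0 chart_jacobianP //; apply: sub_kermxP; rewrite row_sub.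
Qed.

Lemma normal_frame_dual u : frame_domain u ->
  chart_jacobian u *m (normal_frame u)^T = 0 /\ W *m (normal_frame u)^T = 1%:M.
Proof.
move=> [Vu uM]; have := mulmxV uM; rewrite /normal_frame trmxK.
move: (invmx _) => B; rewrite -{1}(hsubmxK B) /completed_jacobian mul_col_row.
rewrite (@scalar_mx_block _ p m 1) => /eq_block_mx[_ -> _ ->] //.
Qed.

Lemma normal_coords u (y : 'rV[R]_n) : frame_domain u -> chart_jacobian u *m y^T = 0 ->
  y = (y *m W^T) *m normal_frame u.
Proof.
move=> [Vu uM] Ty.
have yT : y *m (chart_jacobian u)^T = 0 by rewrite -[LHS]trmxK trmx_mul trmxK Ty trmx0.
have yM : y *m (completed_jacobian u)^T = row_mx 0 (y *m W^T) by rewrite tr_col_mx mul_mx_row yT.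
have uMt : (completed_jacobian u)^T \in unitmx by rewrite unitmx_tr.
rewrite -{1}(mulmxK uMt y) yM -trmx_inv -[invmx (completed_jacobian u)]hsubmxK tr_row_mx.
by rewrite mul_row_col mul0mx add0r.
Qed.

Lemma normal_spaceP u (y : 'rV[R]_n) : V u ->
  normal_space (@euclidean R n) p S (phi u) y <-> chart_jacobian u *m y^T = 0.
Proof.
move=> Vu; split=> [h|h X].
  apply/matrixP => i j; rewrite ord1 [RHS]mxE.
  have : euclidean y ('d phi u (delta_mx 0 i)) = 0.
    by apply: h; apply/(tangent_spaceP id_cont id_inj _ ch Vu); exists (delta_mx 0 i).
  rewrite (metricC eE) dot_mx chart_jacobianP // -mulmxA -rowE mxE //.
move=> /(tangent_spaceP id_cont id_inj _ ch Vu)[x ->].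
by rewrite (metricC eE) dot_mx chart_jacobianP // -mulmxA h mulmx0 mxE.
Qed.

Lemma Ck_chart_jacobian j i l : Ck j V (fun u => chart_jacobian u i l).
Proof.
have [oV s _ _ _] := ch; have [_ h] := s j.+1.
have := @Ck_coord _ _ _ j V _ l oV (h (delta_mx 0 i)).
by apply: Ck_ext oV _ => u Vu; rewrite mxE.
Qed.

Lemma Ck_completed_jacobian j i l : Ck j V (fun u => completed_jacobian u i l).
Proof.
have [oV _ _ _ _] := ch; rewrite -(splitK i); case: (fintype.split i) => a /=.
  by apply: Ck_ext oV _ (Ck_chart_jacobian j a l) => u Vu; rewrite col_mxEu.
by apply: Ck_ext oV _ (Ck_cst _ _ (W a l)) => u Vu; rewrite col_mxEd.
Qed.

Lemma frame_domain_open : open frame_domain.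
Proof.
have [oV _ _ _ _] := ch.
rewrite openE => u [Vu uM].
have nV : \forall w \near u, V w by exact: open_nbhs_nbhs.
have c : {for u, continuous (fun w => \det (completed_jacobian w))}.
  have h : Ck 0 V (fun w => \det (completed_jacobian w) : R).
    by apply: Ck_det oV _ => i j; exact: Ck_completed_jacobian.
  exact: h u Vu.
have d0 : \det (completed_jacobian u) != 0 by rewrite -unitfE -unitmxE.
have nd : \forall w \near u, \det (completed_jacobian w) != 0.
  exact: (cvgr_neq0 (\det (completed_jacobian u)) c d0).
apply: filterS2 nV nd => w Vw dw; split; first exact: Vw.
rewrite unitmxE unitfE; exact: dw.
Qed.

Lemma frame_domain_sub : frame_domain `<=` V. Proof. by move=> u []. Qed.

Lemma chart_frame_domain : chart S frame_domain phi.
Proof. exact: chart_restrict ch frame_domain_open frame_domain_sub. Qed.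

Lemma Ck_normal_frame j a l : Ck j frame_domain (fun u => normal_frame u a l).
Proof.
have h : Ck j frame_domain (fun u => invmx (completed_jacobian u) l (rshift p a)).
  apply: Ck_invmx; first exact: frame_domain_open.
    by move=> u [].
  by move=> i' l'; apply: Ck_sub frame_domain_sub (Ck_completed_jacobian j i' l').
by apply: Ck_ext frame_domain_open _ h => u _; rewrite !mxE.
Qed.

Definition frame_field (s : 'rV[R]_m) u : 'rV[R]_n := s *m normal_frame u.

Lemma frame_field_smooth s : smooth frame_domain (frame_field s).
Proof.
move=> j; apply: Ck_rV frame_domain_open _ => l.
have h : Ck j frame_domain (fun u => \sum_a s 0 a * normal_frame u a l).
  apply: Ck_sum frame_domain_open _ => a; apply: Ck_mul frame_domain_open _ _; first exact: Ck_cst.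
  exact: Ck_normal_frame.
by apply: Ck_ext frame_domain_open _ h => u _; rewrite mxE.
Qed.

Lemma frame_field_differentiable s u : frame_domain u -> differentiable (frame_field s) u.
Proof. by move=> Vu; have [h _] := frame_field_smooth s 1%N; apply: h. Qed.

Lemma frame_field_normal s u : frame_domain u ->
  normal_space (@euclidean R n) p S (phi u) (frame_field s u).
Proof.
move=> Vu; apply/(normal_spaceP _ (frame_domain_sub Vu)).
by rewrite /frame_field trmx_mul mulmxA (normal_frame_dual Vu).1 mul0mx.
Qed.

Lemma frame_field_coords s u : frame_domain u -> frame_field s u *m W^T = s.
Proof.
move=> Vu; rewrite /frame_field -mulmxA -[normal_frame u *m W^T]trmxK trmx_mul trmxK.
by rewrite (normal_frame_dual Vu).2 trmx1 mulmx1.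
Qed.

Definition field_jacobian s u : 'M[R]_(p, n) := \matrix_(i < p) 'D_(delta_mx 0 i) (frame_field s) u.

Lemma field_jacobianP s u x : frame_domain u -> 'D_x (frame_field s) u = x *m field_jacobian s u.
Proof.
move=> Vu; rewrite (deriveE _ (frame_field_differentiable s Vu)) linear_rV_mulmx; congr (_ *m _).
apply/row_matrixP => i; rewrite !rowK; exact: esym (deriveE _ (frame_field_differentiable s Vu)).
Qed.

Lemma field_jacobianZ t s u : frame_domain u -> field_jacobian (t *: s) u = t *: field_jacobian s u.
Proof.
move=> Vu; apply/row_matrixP => i; rewrite rowK linearZ /= rowK.
have -> : frame_field (t *: s) = t \*: frame_field s.
  by apply/funext => w; rewrite /frame_field -scalemxAl.
by apply: deriveZ; apply: diff_derivable; exact: frame_field_differentiable.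
Qed.

(** Up to sign this is the shape form of the field: differentiating its orthogonality
    to the partial derivatives of phi moves the derivative onto phi, where second
    derivatives commute. *)
Lemma field_jacobian_sym s u : frame_domain u ->
  (field_jacobian s u *m (chart_jacobian u)^T)^T =
  field_jacobian s u *m (chart_jacobian u)^T.
Proof.
move=> V'u; have Vu := frame_domain_sub V'u.
have [oV sm _ _ _] := ch.
have key i j : (field_jacobian s u *m (chart_jacobian u)^T) i j =
   - euclidean (frame_field s u) ('D_(delta_mx 0 i) (fun w => 'D_(delta_mx 0 j) phi w) u).
  have d1 : derivable (frame_field s) u (delta_mx 0 i).
    by apply: diff_derivable; exact: frame_field_differentiable.
  have d2 : derivable (fun w => 'D_(delta_mx 0 j) phi w) u (delta_mx 0 i).
    by apply: diff_derivable; have [_ /(_ (delta_mx 0 j)) [h _]] := sm 2%N; exact: h.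
  have [_ D] := is_derive_metric id_cont eE (derivableP d1) (derivableP d2).
  have n0 : \forall w \near u, euclidean (frame_field s w) ('D_(delta_mx 0 j) phi w) = cst 0 w.
    apply: open_near frame_domain_open V'u _ => w V'w.
    apply: frame_field_normal => //.
    apply/(tangent_spaceP id_cont id_inj _ ch (frame_domain_sub V'w)).
    by exists (delta_mx 0 j); exact: (deriveE _ (chart_differentiable ch (frame_domain_sub V'w))).
  rewrite (near_eq_derive _ n0) derive_cst in D.
  have -> : (field_jacobian s u *m (chart_jacobian u)^T) i j =
     euclidean ('D_(delta_mx 0 i) (frame_field s) u) ('D_(delta_mx 0 j) phi u).
    by rewrite mxE; apply: eq_bigr => l _; rewrite !mxE.
  by apply/eqP; rewrite -addr_eq0; apply/eqP; exact: esym D.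
apply/matrixP => i j; rewrite [LHS]mxE (key j i) (key i j).
have S2 := Schwarz id_cont id_inj (delta_mx 0 j) (delta_mx 0 i) oV Vu (sm 2%N).
exact: (congr1 (fun z => - euclidean (frame_field s u) z) S2).
Qed.

Let lpr : {linear 'rV[R]_n -> 'rV[R]_p} := [the {linear 'rV[R]_n -> 'rV[R]_p} of @lsubmx R 1 p m].
Let rpr : {linear 'rV[R]_n -> 'rV[R]_m} := [the {linear 'rV[R]_n -> 'rV[R]_m} of @rsubmx R 1 p m].

Definition bundle_param (z : 'rV[R]_n) : paraD R n :=
  (phi (lsubmx z), frame_field (rsubmx z) (lsubmx z)).
Definition bundle_domain : set 'rV[R]_n := lpr @^-1` frame_domain.

Lemma bundle_domain_open : open bundle_domain.
Proof.
have c : continuous lpr by exact: linear_rV_continuous.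
by apply: open_comp => [w _|]; [exact: c | exact: frame_domain_open].
Qed.

Lemma bundle_param_smooth : smooth bundle_domain bundle_param.
Proof.
move=> j; apply: Ck_pair bundle_domain_open _ _.
  have [_ s _ _ _] := chart_frame_domain.
  exact: (Ck_pre lpr frame_domain_open (s j)).
apply: Ck_rV bundle_domain_open _ => l.
have h : Ck j bundle_domain (fun z => \sum_a rpr z 0 a * normal_frame (lpr z) a l).
  apply: Ck_sum bundle_domain_open _ => a; apply: Ck_mul bundle_domain_open _ _.
    exact: (Ck_coord a bundle_domain_open (Ck_linear rpr j bundle_domain)).
  exact: (Ck_pre lpr frame_domain_open (Ck_normal_frame j a l)).
by apply: Ck_ext bundle_domain_open _ h => u _; rewrite mxE.
Qed.

Lemma is_derive_bundle_param z zeta : bundle_domain z ->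
  is_derive z zeta bundle_param
    (lsubmx zeta *m chart_jacobian (lsubmx z),
     frame_field (rsubmx zeta) (lsubmx z) + lsubmx zeta *m field_jacobian (rsubmx z) (lsubmx z)).
Proof.
move=> Vz; have Vl : V (lsubmx z) by apply: frame_domain_sub.
have lpart (E : normedModType R) (f : 'rV[R]_p -> E) df : is_derive (lsubmx z) (lsubmx zeta) f df ->
   is_derive z zeta (fun z => f (lsubmx z)) df.
  move=> /is_derive_line h; apply/is_derive_line.
  have -> : (fun t : R => f (lsubmx (t *: zeta + z))) = (fun t => f (t *: lsubmx zeta + lsubmx z)).
    by apply/funext => t; rewrite linearP.
  exact: h.
apply: is_derive_pair.
  rewrite -(chart_jacobianP _ Vl) -(deriveE _ (chart_differentiable ch Vl)).
  apply: lpart; apply: derivableP; apply: diff_derivable.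
  exact: (chart_differentiable ch Vl).
apply: is_derive_rV => l.
have DN a : is_derive (lsubmx z) (lsubmx zeta) (fun w => normal_frame w a l : R)
    ('D_(lsubmx zeta) (fun w => normal_frame w a l : R) (lsubmx z)).
  apply: derivableP; apply: diff_derivable.
  by have [h _] := Ck_normal_frame 1 a l; exact: h.
have Dr a : is_derive z zeta (fun z : 'rV[R]_n => rsubmx z 0 a : R) (rsubmx zeta 0 a).
  have d : is_derive z zeta rpr (rsubmx zeta).
    split.
      by apply: diff_derivable; apply: linear_differentiable; exact: linear_rV_continuous.
    rewrite deriveE; last by apply: linear_differentiable; exact: linear_rV_continuous.
    by rewrite diff_lin //; exact: linear_rV_continuous.
  exact: (is_derive_coord a d).
have D := is_derive_sum_seq (index_enum _) (fun a => is_deriveM (Dr a) (lpart _ _ _ (DN a))).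
have e1 : (fun t : 'rV[R]_n => frame_field (rsubmx t) (lsubmx t) 0 l) =
   (fun t => \sum_a rsubmx t 0 a * normal_frame (lsubmx t) a l).
  by apply/funext => t; rewrite mxE.
rewrite e1; apply: (is_derive_eq D).
rewrite big_split /= [RHS]mxE addrC; congr (_ + _).
  by rewrite [RHS]mxE; apply: eq_bigr => a _; rewrite mulrC.
rewrite -(field_jacobianP _ _ Vz).
have Ds := is_derive_sum_seq (index_enum _) (fun a => is_deriveZ (rsubmx z 0 a) (DN a)).
have d : derivable (frame_field (rsubmx z)) (lsubmx z) (lsubmx zeta).
  by apply: diff_derivable; exact: frame_field_differentiable.
have [_ <-] := is_derive_coord l (derivableP d).
have e2 : (fun t => frame_field (rsubmx z) t 0 l) =
    (fun t => \sum_a (rsubmx z 0 a \*: (fun w => normal_frame w a l)) t).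
  by apply/funext => t; rewrite mxE.
by rewrite e2; have [_ ->] := Ds.
Qed.

Lemma bundle_param_diff z zeta : bundle_domain z -> 'd bundle_param z zeta =
    (lsubmx zeta *m chart_jacobian (lsubmx z),
     frame_field (rsubmx zeta) (lsubmx z) + lsubmx zeta *m field_jacobian (rsubmx z) (lsubmx z)).
Proof.
move=> Vz; have d : differentiable bundle_param z.
  by have [h _] := bundle_param_smooth 1%N; exact: h.
rewrite -(deriveE _ d); have [_ h] := is_derive_bundle_param zeta Vz; exact: h.
Qed.

Lemma bundle_param_bundle z : bundle_domain z -> normal_bundle p S (bundle_param z).
Proof.
move=> Vz; split; last exact: frame_field_normal.
have [_ _ _ _ [sub _]] := ch; by apply: sub; exists (lsubmx z) => //; apply: frame_domain_sub.
Qed.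

Lemma bundle_param_onto u y : frame_domain u -> normal_space (@euclidean R n) p S (phi u) y ->
  bundle_param (row_mx u (y *m W^T)) = (phi u, y).
Proof.
move=> Vu /(normal_spaceP _ (frame_domain_sub Vu)) Ty.
by rewrite /bundle_param row_mxKl row_mxKr /frame_field -(normal_coords Vu Ty).
Qed.

(** The inverse map sends (x, y) to the parameter of x and to y W^T; it is continuous
    because phi is open onto S. *)
Lemma bundle_param_nbhs z (B : set 'rV[R]_n) : bundle_domain z -> nbhs z B ->
  nbhs (bundle_param z) [set q | normal_bundle p S q -> exists2 w, B w & bundle_param w = q].
Proof.
move=> Vz zB.
have : nbhs (lsubmx z, rsubmx z) [set us | B (row_mx us.1 us.2)].
  have c := @row_mx_continuous R p m (lsubmx z, rsubmx z).
  by apply: c; rewrite /= hsubmxK.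
move=> [[A1 A2] /= [nA1 nA2] hA].
have [U nU hU] := chart_open chart_frame_domain Vz nA1.
have nY : nbhs (frame_field (rsubmx z) (lsubmx z)) [set y | A2 (y *m W^T)].
  have c : continuous (mulmxr W^T : 'rV[R]_n -> 'rV[R]_m) by exact: linear_rV_continuous.
  by apply: c; rewrite /= frame_field_coords.
exists (U, [set y | A2 (y *m W^T)]) => //.
move=> [x y] /= [Ux A2y] [Sx Ny].
have [u [V'u A1u] ux] := hU x Ux Sx.
rewrite /= -ux in Ny *.
by exists (row_mx u (y *m W^T)); [apply: (hA (u, y *m W^T)) | exact: bundle_param_onto].
Qed.

Lemma bundle_param_chart : chart (normal_bundle p S) bundle_domain bundle_param.
Proof.
have [_ _ inj' sinj' _] := chart_frame_domain.
split; [exact: bundle_domain_open | exact: bundle_param_smooth | | | split].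
- move=> z Vz a b; rewrite (bundle_param_diff a Vz) (bundle_param_diff b Vz) => -[e1 e2].
  have V'z : frame_domain (lsubmx z) := Vz.
  have e3 : lsubmx a = lsubmx b.
    have V_z := frame_domain_sub V'z.
    by apply: (inj' _ V'z); rewrite (chart_jacobianP _ V_z) (chart_jacobianP _ V_z).
  rewrite e3 in e2; move/addIr/(congr1 (mulmx^~ W^T)): e2.
  rewrite (frame_field_coords _ V'z) (frame_field_coords _ V'z) => e4.
  by rewrite -[a]hsubmxK e3 e4 hsubmxK.
- move=> a b /set_mem Va /set_mem Vb e.
  have V'a : frame_domain (lsubmx a) := Va.
  have V'b : frame_domain (lsubmx b) := Vb.
  have e1 : phi (lsubmx a) = phi (lsubmx b) := congr1 fst e.
  have e2 : frame_field (rsubmx a) (lsubmx a) = frame_field (rsubmx b) (lsubmx b) := congr1 snd e.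
  have e3 : lsubmx a = lsubmx b := sinj' _ _ (mem_set V'a) (mem_set V'b) e1.
  rewrite e3 in e2; move: e2 => /(congr1 (mulmx^~ W^T)).
  rewrite (frame_field_coords _ V'b) (frame_field_coords _ V'b) => e4.
  by rewrite -[a]hsubmxK e3 e4 hsubmxK.
- by move=> _ [z Vz <-]; exact: bundle_param_bundle.
move=> B oB BVV.
(* The largest open set whose points in the bundle all lie in the image of B. *)
exists ([set q | normal_bundle p S q -> (bundle_param @` B) q]°).
  exact: open_interior.
apply/seteqP; split=> [_ [z Bz <-]|q [/interior_subset h /h //]].
split; last by apply: bundle_param_bundle; exact: BVV.
have := bundle_param_nbhs (BVV _ Bz) (open_nbhs_nbhs (conj oB Bz)).
by apply: filterS => q h /h [w Bw <-]; exists w.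
Qed.

(** Tangent and normal parts are orthogonal, and the remaining terms cancel by the
    symmetry of the shape form. *)
Lemma bundle_param_lagrangian z x y : bundle_domain z ->
  neutral ('d bundle_param z x) (para_J ('d bundle_param z y)) = 0.
Proof.
move=> Vz; have Vl := frame_domain_sub Vz; rewrite !bundle_param_diff // neutral_dot /para_J /=.
set u := lsubmx z in Vz Vl *; set D := field_jacobian _ _.
have TN (a : 'rV[R]_p) (s : 'rV[R]_m) : (a *m chart_jacobian u) *m (frame_field s u)^T = 0.
  rewrite /frame_field trmx_mul -mulmxA (mulmxA (chart_jacobian u)).
  by rewrite (normal_frame_dual Vz).1 mul0mx mulmx0.
have NT (a : 'rV[R]_p) (s : 'rV[R]_m) : frame_field s u *m (a *m chart_jacobian u)^T = 0.
  by rewrite -[LHS]trmxK trmx_mul trmxK TN trmx0.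
rewrite [(_ + _)^T]linearD /= mulmxDr TN add0r mulmxDl NT add0r.
have e := mulmx_sym_swap (lsubmx x) (lsubmx y) (field_jacobian_sym (rsubmx z) Vz).
rewrite e; exact: subrr.
Qed.

Lemma tangent_mx_bundle_param z : bundle_domain z ->
  tangent_mx bundle_param [the {linear paraD R n -> 'rV[R]_n} of @null_plus R n] z =
    col_mx (chart_jacobian (lsubmx z) + field_jacobian (rsubmx z) (lsubmx z))
      (normal_frame (lsubmx z)) /\
  tangent_mx bundle_param [the {linear paraD R n -> 'rV[R]_n} of @null_minus R n] z =
    col_mx (chart_jacobian (lsubmx z) - field_jacobian (rsubmx z) (lsubmx z))
      (- normal_frame (lsubmx z)).
Proof.
move=> Vz.
have Dl i : 'D_(delta_mx 0 (lshift m i)) bundle_param z =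
    (row i (chart_jacobian (lsubmx z)), row i (field_jacobian (rsubmx z) (lsubmx z))) :> paraD R n.
  have [_ ->] := is_derive_bundle_param (delta_mx 0 (lshift m i)) Vz.
  have -> : lsubmx (delta_mx 0 (lshift m i) : 'rV[R]_n) = delta_mx 0 i.
    by apply/rowP => j; rewrite !mxE eqxx /= (inj_eq (@lshift_inj _ _)).
  have -> : rsubmx (delta_mx 0 (lshift m i) : 'rV[R]_n) = 0.
    by apply/rowP => j; rewrite !mxE eqxx /= eq_rlshift.
  by rewrite /frame_field mul0mx add0r -!rowE.
have Dr i : 'D_(delta_mx 0 (rshift p i)) bundle_param z =
    (0, row i (normal_frame (lsubmx z))) :> paraD R n.
  have [_ ->] := is_derive_bundle_param (delta_mx 0 (rshift p i)) Vz.
  have -> : rsubmx (delta_mx 0 (rshift p i) : 'rV[R]_n) = delta_mx 0 i.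
    by apply/rowP => j; rewrite !mxE eqxx /= (inj_eq (@rshift_inj _ _)).
  have -> : lsubmx (delta_mx 0 (rshift p i) : 'rV[R]_n) = 0.
    by apply/rowP => j; rewrite !mxE eqxx /= eq_lrshift.
  by rewrite !mul0mx addr0 /frame_field -rowE.
split; apply/row_matrixP => i; rewrite rowK -(splitK i); case: (fintype.split i) => a /=.
- by rewrite Dl rowKu linearD.
- by rewrite Dr rowKd /null_plus /= add0r.
- by rewrite Dl rowKu linearB.
- by rewrite Dr rowKd /null_minus /= sub0r linearN.
Qed.

End NormalBundleChart.

(** * Austerity in terms of determinants *)

Section AustereMinimal.
Variables (R : realType) (p m : nat).
Local Notation n := (p + m)%N.
Variables (S : set 'rV[R]_n) (V : set 'rV[R]_p) (phi : 'rV[R]_p -> 'rV[R]_n).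
Hypothesis ch : chart S V phi.
Variable W : 'M[R]_(m, n).
Let eE := @euclideanE R n.
Let id_cont := @euclidean_coords_continuous R n.
Let id_inj := @euclidean_coords_inj R n.
Let nE := @neutralE R n.
Let io_cont := @neutral_coords_continuous R n.
Let io_inj := @neutral_coords_inj R n.

Local Notation T := (chart_jacobian phi).
Local Notation N := (normal_frame phi W).
Local Notation D := (field_jacobian phi W).
Local Notation Dom := (frame_domain V phi W).
Local Notation BDom := (bundle_domain V phi W).
Local Notation Phi := (bundle_param phi W).
Local Notation np := [the {linear paraD R n -> 'rV[R]_n} of @null_plus R n].
Local Notation nm := [the {linear paraD R n -> 'rV[R]_n} of @null_minus R n].

Let lagr := @bundle_param_lagrangian _ _ _ _ _ _ ch W.

Lemma euclidean_frame_exists u : V u ->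
  exists f : 'I_p -> 'rV[R]_n, orthonormal_frame (@euclidean R n) S (phi u) f.
Proof.
move=> Vu; apply: (frame_exists id_cont id_inj eE ch Vu).
have -> : (\matrix_(i, j) euclidean ('d phi u (delta_mx 0 i)) ('d phi u (delta_mx 0 j))) =
    T u *m (T u)^T.
  apply/matrixP => i j; rewrite [LHS]mxE (chart_jacobianP ch _ Vu) (chart_jacobianP ch _ Vu) dot_mx.
  by rewrite -!rowE tr_row colE mulmxA -colE -row_mul !mxE.
exact: gram_unitmx (chart_jacobian_free ch Vu).
Qed.

Lemma euclidean_frame_coords u (f : 'I_p -> 'rV[R]_n) : V u ->
  orthonormal_frame (@euclidean R n) S (phi u) f ->
  exists F : 'M[R]_p, (forall i, f i = 'd phi u (row i F)) /\
    F *m (T u *m (T u)^T) *m F^T = 1%:M.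
Proof.
move=> Vu fr; have [F _ fF] := frame_coords id_cont id_inj eE ch Vu fr.
exists F; split => //; have [_ nf orth] := fr.
apply/matrixP => i j.
have -> : (F *m (T u *m (T u)^T) *m F^T) i j = euclidean (f i) (f j).
  rewrite !fF (chart_jacobianP ch _ Vu) (chart_jacobianP ch _ Vu) dot_mx trmx_mul.
  rewrite tr_row colE !mulmxA -colE.
  by rewrite -!row_mul !mxE.
rewrite [RHS]mxE; case: eqVneq => [->|ij]; last exact: orth.
case: (nf j) => // neg; have : 0 <= euclidean (f j) (f j).
  by apply: sumr_ge0 => l _; rewrite -expr2 sqr_ge0.
by rewrite neg ler0N1.
Qed.

(** In an orthonormal frame with coordinate matrix F, where F T T^T F^T = 1, the
    shape matrix is - F D T^T F^T. *)
Lemma shape_mx_det u s (f : 'I_p -> 'rV[R]_n) : Dom u ->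
  orthonormal_frame (@euclidean R n) S (phi u) f ->
  let A := \matrix_(i < p, j < p)
     shape_form (@euclidean R n) p S (phi u) (frame_field phi W s u) (f i) (f j) in
  A^T = A /\ exists2 c, c != 0 & forall t,
    \det (1%:M + t *: A) = c * \det (T u *m (T u)^T - t *: (D s u *m (T u)^T)).
Proof.
move=> V'u fr A; have Vu := frame_domain_sub V'u.
have [F [fF FG]] := euclidean_frame_coords Vu fr.
have AE : A = - (F *m (D s u *m (T u)^T) *m F^T).
  apply/matrixP => i j; rewrite [LHS]mxE [RHS]mxE /shape_form.
  have [te _ _] := fr.
  have hnu w : Dom w -> differentiable (frame_field phi W s) w /\
      normal_space (@euclidean R n) p S (phi w) (frame_field phi W s w).
    move=> V'w; split; first exact: (frame_field_differentiable ch s V'w).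
    exact: (frame_field_normal ch s V'w).
  have [_ h] := second_ff_normal_field id_cont id_inj eE (row i F)
    (chart_frame_domain ch W) V'u fr (te j) hnu.
  rewrite -fF in h; rewrite h (field_jacobianP ch _ _ V'u) fF (chart_jacobianP ch _ Vu).
  rewrite (metricC eE) dot_mx; congr (- _).
  by rewrite trmx_mul tr_row colE !mulmxA -colE -!row_mul !mxE.
have uF : \det F != 0.
  have [uF _] := mulmx1_unit (etrans (mulmxA _ _ _) FG).
  by rewrite -unitfE -unitmxE.
split.
  rewrite AE; move: (_ *m (T u)^T) (field_jacobian_sym ch s V'u) => B sB.
  by rewrite linearN /= !trmx_mul trmxK sB mulmxA.
exists (\det F * \det F); first by rewrite mulf_neq0.
move=> t; rewrite AE -FG.
have -> : F *m (T u *m (T u)^T) *m F^T + t *: - (F *m (D s u *m (T u)^T) *m F^T) =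
   F *m (T u *m (T u)^T - t *: (D s u *m (T u)^T)) *m F^T.
  by rewrite mulmxBr mulmxBl scalerN -scalemxAr -scalemxAl.
by rewrite !det_mulmx det_tr mulrAC.
Qed.

Lemma normal_frame_free u : Dom u -> row_free (N u).
Proof.
move=> V'u; apply/row_freeP; exists W^T.
by rewrite -[LHS]trmxK trmx_mul trmxK (normal_frame_dual V'u).2 trmx1.
Qed.

Lemma det_tangent_mx u : Dom u -> exists2 c, c != 0 & forall s,
  \det (tangent_mx Phi np (row_mx u s)) =
    c * \det (T u *m (T u)^T + D s u *m (T u)^T) /\
  \det (tangent_mx Phi nm (row_mx u s)) =
    (-1) ^+ m * c * \det (T u *m (T u)^T - D s u *m (T u)^T).
Proof.
move=> V'u; have Vu := frame_domain_sub V'u.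
have [c c0 hc] := det_orthogonal_split (chart_jacobian_free ch Vu)
  (normal_frame_free V'u) (normal_frame_dual V'u).1.
exists c => // s.
have Vz : BDom (row_mx u s) by rewrite /bundle_domain /preimage /= row_mxKl.
have [-> ->] := tangent_mx_bundle_param ch Vz.
by rewrite row_mxKl row_mxKr; exact: hc.
Qed.

Lemma is_derive_det_tangent (L : {linear paraD R n -> 'rV[R]_n}) z eta :
  continuous L -> BDom z ->
  is_derive z eta (fun y => \det (tangent_mx Phi L y))
    (\tr (tangent_mx_deriv Phi L eta z *m \adj (tangent_mx Phi L z))).
Proof.
move=> cL Vz; apply: is_derive_det => i j.
exact: (is_derive_tangent_mx (bundle_param_chart ch W) eta i j cL Vz).
Qed.

(** Austerity holds at every normal vector, so the quotient of the two determinants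
    is constant on the whole parameter domain. *)
Lemma austere_det : austere (@euclidean R n) p S -> forall z, BDom z ->
  \det (tangent_mx Phi nm z) = (-1) ^+ m * \det (tangent_mx Phi np z).
Proof.
move=> aus z Vz; rewrite -[z]hsubmxK; set u := lsubmx z; set s := rsubmx z.
have V'u : Dom u := Vz.
have [c c0 hc] := det_tangent_mx V'u.
have [-> ->] := hc s; rewrite mulrA; congr (_ * _).
have [f fr] := euclidean_frame_exists (frame_domain_sub V'u).
have [symA [d d0 hd]] := shape_mx_det s V'u fr.
have nf : normal_field (@euclidean R n) S Dom phi (frame_field phi W s).
  by split; [exact: (frame_field_smooth ch) | move=> w V'w; exact: (frame_field_normal ch s V'w)].
have := mup_sym_det symA (aus _ _ _ (chart_frame_domain ch W) nf u V'u f fr).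
have := hd 1; have := hd (-1).
rewrite !scaleN1r !scale1r opprK => -> -> /(mulfI d0) -> //.
Qed.

Lemma austere_mean_curvature u y (e : 'I_n -> paraD R n) : austere (@euclidean R n) p S -> Dom u ->
  normal_bundle p S (phi u, y) ->
  orthonormal_frame (@neutral R n) (normal_bundle p S) (phi u, y) e ->
  mean_curvature (@neutral R n) (normal_bundle p S) (phi u, y) e = 0.
Proof.
move=> aus V'u [Su Ny]; rewrite -(bundle_param_onto ch V'u Ny) => fr.
set z := row_mx _ _ in fr *.
have Vz : BDom z by rewrite /bundle_domain /preimage /= row_mxKl.
apply/(mean_curvature_lagrangian (bundle_param_chart ch W) lagr Vz fr) => eta.
have DP := is_derive_det_tangent (L := np) eta (@null_plus_continuous R n) Vz.
have DQ := is_derive_det_tangent (L := nm) eta (@null_minus_continuous R n) Vz.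
have e1 : \forall w \near z, (-1) ^+ m * \det (tangent_mx Phi np w) = \det (tangent_mx Phi nm w).
  have h w (Vw : BDom w) : (-1) ^+ m * \det (tangent_mx Phi np w) = \det (tangent_mx Phi nm w).
    exact: esym (austere_det aus Vw).
  have oVV : open BDom by exact: (bundle_domain_open ch).
  exact: open_near oVV Vz h.
have [_ d1] := near_eq_is_derive e1 (is_deriveZ ((-1) ^+ m) DP).
have [_ d2] := DQ.
have trE := etrans (esym d2) d1.
rewrite trE (austere_det aus Vz) /GRing.scale /=.
by rewrite -mulrA mulrCA.
Qed.

Lemma neutral_frame_exists z : BDom z ->
  \det (tangent_mx Phi np z) != 0 -> \det (tangent_mx Phi nm z) != 0 ->
  exists e : 'I_n -> paraD R n,
    orthonormal_frame (@neutral R n) (normal_bundle p S) (Phi z) e.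
Proof.
move=> Vz p0 q0.
apply: (frame_exists io_cont io_inj nE (bundle_param_chart ch W) Vz).
have -> : (\matrix_(i, j) neutral ('d Phi z (delta_mx 0 i)) ('d Phi z (delta_mx 0 j))) =
    tangent_mx Phi np z *m (tangent_mx Phi nm z)^T.
  apply/matrixP => i j; rewrite [LHS]mxE.
  rewrite (neutral_tangent_mx (bundle_param_chart ch W) lagr _ _ Vz).
  exact: mulmx_deltas.
by rewrite unitmx_mul unitmx_tr !unitmxE !unitfE p0.
Qed.

(** Along the ray of the multiples t s in a fibre the two determinants are
    polynomials in t. Where they do not vanish the metric is non-degenerate and
    admits a frame, so minimality applies and equates their logarithmic derivatives. *)
Lemma minimal_pencil u s : minimal (@neutral R n) n (normal_bundle p S) -> Dom u ->
  forall t, \det (T u *m (T u)^T + t *: (D s u *m (T u)^T)) =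
            \det (T u *m (T u)^T - t *: (D s u *m (T u)^T)).
Proof.
move=> mini V'u; have Vu := frame_domain_sub V'u.
set G := T u *m (T u)^T; set B := D s u *m (T u)^T.
have [f fE] := det_pencil G B; have [g gE] := det_pencil G (- B).
have [c c0 hc] := det_tangent_mx V'u.
have Vz t : BDom (row_mx u (t *: s)) by rewrite /bundle_domain /preimage /= row_mxKl.
have hP t : \det (tangent_mx Phi np (row_mx u (t *: s))) = c * f.[t].
  by rewrite (hc _).1 (field_jacobianZ ch t s V'u) -scalemxAl fE.
have hQ t : \det (tangent_mx Phi nm (row_mx u (t *: s))) = (-1) ^+ m * c * g.[t].
  by rewrite (hc _).2 (field_jacobianZ ch t s V'u) -scalemxAl gE scalerN.
have sgn0 : (-1) ^+ m != 0 :> R by rewrite signr_eq0.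
have G0 : \det G != 0.
  by rewrite -unitfE -unitmxE; exact: gram_unitmx (chart_jacobian_free ch Vu).
suff fg : f = g.
  by move=> t; rewrite -fE fg gE scalerN.
apply: poly_logderiv_eq.
- by rewrite fE gE !scale0r.
- by rewrite fE scale0r addr0.
move=> t ft gt; set z := row_mx u (t *: s).
have [e fr] : exists e : 'I_n -> paraD R n,
    orthonormal_frame (@neutral R n) (normal_bundle p S) (Phi z) e.
  by apply: neutral_frame_exists (Vz t) _ _; rewrite ?hP ?hQ !mulf_neq0.
have nd := frame_nondegenerate io_cont io_inj nE
  (bundle_param_chart ch W) (Vz t) fr.
have H0 := mini _ (bundle_param_bundle ch (Vz t)) nd e fr.
pose eta : 'rV[R]_n := row_mx 0 s.
have /(_ eta) key := (mean_curvature_lagrangian (bundle_param_chart ch W)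
  lagr (Vz t) fr).1 H0.
have line h : h *: eta + z = row_mx u ((h + t) *: s).
  by rewrite /eta /z scale_row_mx add_row_mx scaler0 add0r scalerDl.
have dpoly (q : {poly R}) k : is_derive (0 : R) (1 : R) (fun h => k * q.[h + t]) (k * q^`().[t]).
  have -> : (fun h => k * q.[h + t]) = k \*: horner (q \Po ('X + t%:P)).
    by apply/funext => h /=; rewrite horner_comp !hornerE.
  have -> : k * q^`().[t] = k *: (q \Po ('X + t%:P))^`().[0].
    by rewrite deriv_comp derivD derivX derivC addr0 mulr1 horner_comp !hornerE.
  by apply: is_deriveZ.
have DP : \tr (tangent_mx_deriv Phi np eta z *m \adj (tangent_mx Phi np z)) = c * f^`().[t].
  have /is_derive_line := is_derive_det_tangent (L := np) eta (@null_plus_continuous R n) (Vz t).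
  have -> : (fun h : R => \det (tangent_mx Phi np (h *: eta + z))) = (fun h => c * f.[h + t]).
    by apply/funext => h; rewrite line hP.
  by move=> [_ <-]; have [_ ->] := dpoly f c.
have DQ : \tr (tangent_mx_deriv Phi nm eta z *m \adj (tangent_mx Phi nm z)) =
    (-1) ^+ m * c * g^`().[t].
  have /is_derive_line := is_derive_det_tangent (L := nm) eta (@null_minus_continuous R n) (Vz t).
  have -> : (fun h : R => \det (tangent_mx Phi nm (h *: eta + z))) =
      (fun h => (-1) ^+ m * c * g.[h + t]).
    by apply/funext => h; rewrite line hQ.
  by move=> [_ <-]; have [_ ->] := dpoly g ((-1) ^+ m * c).
rewrite DP DQ hP hQ in key.
apply: (mulfI (mulf_neq0 (mulf_neq0 sgn0 c0) c0)).
move: key; move: (f^`().[t]) (g^`().[t]) (f.[t]) (g.[t]) ((-1) ^+ m) => f' g' f0 g0 sg key.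
have -> : sg * c * c * (f' * g0) = sg * c * g0 * (c * f') by ring.
by rewrite key; ring.
Qed.

Lemma minimal_mup u (e : 'I_p -> 'rV[R]_n) y : minimal (@neutral R n) n (normal_bundle p S) ->
  Dom u -> normal_space (@euclidean R n) p S (phi u) y ->
  orthonormal_frame (@euclidean R n) S (phi u) e ->
  let A := \matrix_(i < p, j < p) shape_form (@euclidean R n) p S (phi u) y (e i) (e j) in
  forall x, mup x (char_poly A) = mup (- x) (char_poly A).
Proof.
move=> mini V'u /(normal_spaceP ch _ (frame_domain_sub V'u)) Ty fr.
rewrite (normal_coords V'u Ty) -/(frame_field phi W (y *m W^T) u) => A.
have [_ [c c0 hc]] := shape_mx_det (y *m W^T) V'u fr.
apply: det_sym_mup => t; have := hc t; have := hc (- t).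
rewrite !scaleNr opprK => -> ->; congr (_ * _).
exact: esym (minimal_pencil (y *m W^T) mini V'u t).
Qed.

End AustereMinimal.

Lemma chart_dim (R : realType) n p (S : set 'rV[R]_n) (V : set 'rV[R]_p) phi u :
  chart S V phi -> V u -> (p <= n)%N.
Proof.
move=> [_ _ inj _ _] Vu.
have fr : row_free (\matrix_(i < p) 'd phi u (delta_mx 0 i)).
  rewrite -kermx_eq0; apply/eqP/row_matrixP => i; rewrite row0.
  apply: (inj _ Vu); rewrite linear0 linear_rV_mulmx.
  by apply: sub_kermxP; rewrite row_sub.
by rewrite -(eqP fr) rank_leq_col.
Qed.

Lemma adapted_complement (R : realType) p m (S : set 'rV[R]_(p + m)) (V : set 'rV[R]_p) phi u :
  chart S V phi -> V u -> exists W, frame_domain V phi W u.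
Proof.
by move=> ch Vu; have [W uW] := complete_unitmx (chart_jacobian_free ch Vu); exists W.
Qed.

Theorem theorem5 (R : realType) (n p : nat) (S : set 'rV[R]_n)
    (hS : submanifold p S) :
  minimal (@neutral R n) n (normal_bundle p S) <->
  austere (@euclidean R n) p S.
Proof.
split=> [mini V phi nu ch [snu nnu] u Vu e fr A|aus q [Sq Nq] _ e fr].
  have pn := chart_dim ch Vu; have [m nE] : exists m, n = (p + m)%N.
    by exists (n - p)%N; rewrite subnKC.
  subst n; have [W V'u] := adapted_complement ch Vu.
  exact: (minimal_mup ch mini V'u (nnu u Vu) fr).
have [V [phi [ch [u Vu uq]]]] := hS _ Sq.
have pn := chart_dim ch Vu; have [m nE] : exists m, n = (p + m)%N.
  by exists (n - p)%N; rewrite subnKC.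
subst n; have [W V'u] := adapted_complement ch Vu.
case: q Sq Nq fr uq => x y /= Sx Ny fr ux; subst x.
exact: (austere_mean_curvature ch aus V'u).
Qed.
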